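(* Let $K$ be a knot in $S^3$ with group $\pi$, let $\alpha\in\mathbb{C}^*$ be a root of the Alexander polynomial $\Delta_K(t)$, and let $\tau_\alpha\cong\bigoplus_{i=1}^{k_\alpha}\Lambda/(t-\alpha)^{q_i}$ be the $(t-\alpha)$-primary part of the complex Alexander module $H_1(X^\infty,\mathbb{C})$, with the exponents ordered so that $1\leq q_1\leq\cdots\leq q_{k_\alpha}$. Then: 1. For $n\geq 2$, the vector space $\overline{C}_n$ is nonzero if and only if there exists $1\leq i\leq k_\alpha$ such that $q_i\geq n-1$. 2. The spaces $\overline{C}_p$ form a filtration of $H^1(\pi,\mathbb{C}_\alpha)$: $$\{0\}=\overline{C}_{q_{k_\alpha}+2}\subsetneq \overline{C}_{q_{k_\alpha}+1}\subseteq \overline{C}_{q_{k_\alpha}}\subseteq\cdots\subseteq \overline{C}_2=H^1(\pi,\mathbb{C}_\alpha).$$ 3. For every $p\geq 3$, the codimension of $\overline{C}_p$ in $\overline{C}_{p-1}$ equals the number of $q_i$ equal to $p-2$, i.e. $$\dim \overline{C}_{p-1}-\dim \overline{C}_p=\operatorname{card}\{1\leq i\leq k_\alpha\mid q_i=p-2\}.$$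
   Context: Let $K$ be a knot in $S^3$, $X=\overline{S^3\setminus V(K)}$ its exterior ($V(K)$ a tubular neighbourhood of $K$), $\pi=\pi_1(X)$, $\mu\in\pi$ a meridian, $\pi'=[\pi,\pi]$, $\pi''=[\pi',\pi']$. Let $T=\langle t\mid -\rangle\cong\pi/\pi'$ be infinite cyclic, generated by the image $t$ of $\mu$, and for $\gamma\in\pi$ let $|\gamma|\in\mathbb{Z}$ be the image of $\gamma$ under $\pi\to\pi/\pi'\cong\mathbb{Z}$, so $|\mu|=1$. Put $\Lambda=\mathbb{C}[t,t^{-1}]$ and let $X^\infty$ be the infinite cyclic cover of $X$ corresponding to $\pi'$. The complex Alexander module $H_1(X^\infty,\mathbb{C})\cong\pi'/\pi''\otimes_{\mathbb{Z}}\mathbb{C}$ is a $\Lambda$-module by $t\cdot(y\otimes z)=(\mu y\mu^{-1})\otimes z$; it is a finitely generated torsion $\Lambda$-module, its order ideal is principal, and any generator of this ideal is an Alexander polynomial $\Delta_K(t)$. It decomposes as $\bigoplus_{\Delta_K(\beta)=0}\tau_\beta$, where $\tau_\beta\cong\bigoplus_{i=1}^{k_\beta}\Lambda/(t-\beta)^{q_i}$ with $q_i\in\mathbb{N}^*$ (depending on $\beta$); $k_\beta$ is the number of cyclic summands of $\tau_\beta$. For $\alpha\in\mathbb{C}^*$, $\mathbb{C}_\alpha$ is the $\pi$-module $\mathbb{C}$ with action $\gamma\cdot z=\alpha^{|\gamma|}z$. $C^1(\pi,\mathbb{C}_\alpha)$ is the space of all functions $\pi\to\mathbb{C}$; $Z^1(\pi,\mathbb{C}_\alpha)$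 is the space of $f$ with $f(\gamma_1\gamma_2)=f(\gamma_1)+\alpha^{|\gamma_1|}f(\gamma_2)$ for all $\gamma_1,\gamma_2\in\pi$; $B^1(\pi,\mathbb{C}_\alpha)$ is the space of functions $\gamma\mapsto(\alpha^{|\gamma|}-1)a$, $a\in\mathbb{C}$; $H^1(\pi,\mathbb{C}_\alpha)=Z^1(\pi,\mathbb{C}_\alpha)/B^1(\pi,\mathbb{C}_\alpha)$, and $\{U\}$ denotes the class of $U\in Z^1(\pi,\mathbb{C}_\alpha)$. $G_n$ is the group of invertible upper triangular $n\times n$ complex matrices. For $m\geq1$, $\phi_m:\pi\to GL(m,\mathbb{C})$ is the homomorphism factoring through $\pi/\pi'$ with $\phi_m(\mu)=I_m+\mathcal{N}_m$, where $\mathcal{N}_m$ has $1$'s on the first superdiagonal and $0$ elsewhere. For $V=(v_1,\ldots,v_{n-1})\in (C^1(\pi,\mathbb{C}_\alpha))^{n-1}$ define the map $\rho_n^V:\pi\to G_n$ by $$\rho_n^V(\gamma)=\begin{pmatrix}\alpha^{|\gamma|}&V(\gamma)\\ 0&\phi_{n-1}(\gamma)\end{pmatrix},$$ where $V(\gamma)$ is the row vector $(v_1(\gamma),\ldots,v_{n-1}(\gamma))$. For $n\geq 2$ set $$\overline{C}_n=\{\{U\}\in H^1(\pi,\mathbb{C}_\alpha)\mid \exists\,(v_2,\ldots,v_{n-1})\in (C^1(\pi,\mathbb{C}_\alpha))^{n-2}\text{ such that }\rho_n^{(U,v_2,\ldots,v_{n-1})}\text{ is a group homomorphism}\}.$$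 The condition does not depend on the representative $U$ of its class (changing $U$ by a coboundary corresponds to conjugating the representation), and $\overline{C}_n$ is a complex vector subspace of $H^1(\pi,\mathbb{C}_\alpha)$. *)

(* Defs.v *)
From HB Require Import structures.
From mathcomp Require Import all_boot all_order all_algebra generic_quotient.
From mathcomp Require Import ring_quotient fraction complex.
From mathcomp Require Import all_classical all_reals all_analysis lra ring.

Set Implicit Arguments.
Unset Strict Implicit.
Unset Printing Implicit Defensive.

Import Order.TTheory GRing.Theory Num.Theory.
Import numFieldNormedType.Exports.

Local Open Scope classical_set_scope.
Local Open Scope quotient_scope.
Local Open Scope ring_scope.

(** * Groups *)

Section Derived.
Local Open Scope group_scope.
Variable G : groupType.

(* The smallest subgroup of [G] containing all commutators. *)
Definition commutators_gen (x : G) : Prop :=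
  forall S : {pred G}, group_closed S -> (forall a b, [~ a, b] \in S) ->
    x \in S.

Definition derived_pred : {pred G} := [pred x | `[< commutators_gen x >]].

Lemma derived_predP x : reflect (commutators_gen x) (x \in derived_pred).
Proof. by rewrite inE; exact: asboolP. Qed.

Lemma derived_group_closed : group_closed derived_pred.
Proof.
split=> [|x y /derived_predP Gx /derived_predP Gy].
  by apply/derived_predP => S [].
apply/derived_predP => S gS cS; case: (gS) => S1 SF.
by apply: SF; [exact: Gx | exact: Gy].
Qed.

Lemma derived_comm a b : [~ a, b] \in derived_pred.
Proof. by apply/derived_predP => S _; apply. Qed.

Lemma derived1 : 1 \in derived_pred.
Proof. exact: derived_group_closed.1. Qed.

Lemma derivedM x y :
  x \in derived_pred -> y \in derived_pred -> x * y \in derived_pred.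
Proof. exact: group_closedM derived_group_closed x y. Qed.

Lemma derivedV x : x \in derived_pred -> x^-1 \in derived_pred.
Proof. exact: group_closedV derived_group_closed x. Qed.

Record derived_group := DerivedGroup {
  derived_val :> G; derived_valP : derived_val \in derived_pred }.

HB.instance Definition _ := [isSub for derived_val].
HB.instance Definition _ := [Choice of derived_group by <:].
HB.instance Definition _ :=
  SubChoice_isSubGroup.Build G derived_pred derived_group derived_group_closed.
Lemma derived_conj (g y : G) : y \in derived_pred ->
  g * y * g^-1 \in derived_pred.
Proof.
move=> Gy; have -> : g * y * g^-1 = y * [~ y, g^-1].
  by rewrite /commg /conjg invgK !mulgA mulgV mul1g.
by apply: derivedM => //; exact: derived_comm.
Qed.

(* The automorphism [y |-> g y g^-1] of the derived group. *)
Definition conj_derived (g : G) (y : derived_group) : derived_group :=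
  DerivedGroup (derived_conj g (derived_valP y)).

(* The abelianization [G / [G, G]], written additively. *)
Definition ab_equiv (x y : G) : bool := x^-1 * y \in derived_pred.

Lemma ab_equiv_class : equiv_class_of ab_equiv.
Proof.
split=> [x|x y|y x z]; rewrite /ab_equiv.
- by rewrite mulVg derived1.
- by apply/idP/idP => /derivedV; rewrite invgM invgK.
- move=> xy yz; rewrite -(mulVKg y z) mulgA.
  exact: derivedM.
Qed.

Canonical ab_equiv_rel := EquivRelPack ab_equiv_class.

Definition abelianization := {eq_quot ab_equiv_rel}.
HB.instance Definition _ := Choice.on abelianization.

Definition to_ab (x : G) : abelianization := \pi_abelianization x.

Lemma to_abP x y : to_ab x = to_ab y <-> x^-1 * y \in derived_pred.
Proof.
split; first by move/eqP; rewrite eqmodE.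
by move=> h; apply/eqP; rewrite eqmodE.
Qed.

Definition ab_zero : abelianization := to_ab 1.
Definition ab_add (u v : abelianization) := to_ab (repr u * repr v).
Definition ab_opp (u : abelianization) := to_ab (repr u)^-1.

Lemma repr_to_ab x : to_ab (repr (to_ab x)) = to_ab x.
Proof. by rewrite /to_ab reprK. Qed.

Lemma to_ab_repr u : to_ab (repr u) = u.
Proof. by rewrite /to_ab reprK. Qed.

Lemma ab_addE x y : ab_add (to_ab x) (to_ab y) = to_ab (x * y).
Proof.
have /to_abP hx := repr_to_ab x; have /to_abP hy := repr_to_ab y.
apply/to_abP; rewrite invgM.
set x' := repr _ in hx *; set y' := repr _ in hy *.
have -> : y'^-1 * x'^-1 * (x * y)
        = (y'^-1 * (x'^-1 * x) * y'^-1^-1) * (y'^-1 * y).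
  by rewrite !mulgA mulgVK.
by apply: derivedM => //; exact: derived_conj.
Qed.

Lemma ab_oppE x : ab_opp (to_ab x) = to_ab x^-1.
Proof.
have /to_abP hx := repr_to_ab x; apply/to_abP; rewrite invgK.
set x' := repr _ in hx *.
have -> : x' * x^-1 = x' * (x'^-1 * x)^-1 * x'^-1.
  by rewrite invgM invgK !mulgA mulgK.
by apply: derived_conj; exact: derivedV.
Qed.

Lemma ab_addA : associative ab_add.
Proof.
move=> u v w; rewrite -(to_ab_repr u) -(to_ab_repr v) -(to_ab_repr w).
by rewrite !ab_addE mulgA.
Qed.

Lemma ab_addC : commutative ab_add.
Proof.
move=> u v; rewrite -(to_ab_repr u) -(to_ab_repr v) !ab_addE.
apply/to_abP; rewrite invgM -mulgA.
exact: derived_comm.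
Qed.

Lemma ab_add0 : left_id ab_zero ab_add.
Proof. by move=> u; rewrite -(to_ab_repr u) ab_addE mul1g. Qed.

Lemma ab_addN : left_inverse ab_zero ab_opp ab_add.
Proof. by move=> u; rewrite -(to_ab_repr u) ab_oppE ab_addE mulVg. Qed.

HB.instance Definition _ :=
  GRing.isZmodule.Build abelianization ab_addA ab_addC ab_add0 ab_addN.

End Derived.

Arguments derived_pred : clear implicits.

(** * Quotient vector spaces *)

Section QuotientLmodule.
Variables (F : fieldType) (V : lmodType F) (W : submodClosed V).

(* [submodClosed] does not inherit from [zmodClosed]. *)
Definition zmod_of_submod : {pred V} := W.

Lemma zmod_of_submod_closed : zmod_closed zmod_of_submod.
Proof.
rewrite /zmod_of_submod; split=> [|u v Wu Wv]; first exact: rpred0.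
by rewrite -scaleN1r; apply: rpredD => //; exact: rpredZ.
Qed.

HB.instance Definition _ :=
  GRing.isZmodClosed.Build V zmod_of_submod zmod_of_submod_closed.

Definition lquot := Quotient.quot zmod_of_submod.
HB.instance Definition _ := GRing.Zmodule.on lquot.

Definition to_lquot (v : V) : lquot :=
  \pi_(Quotient.quot zmod_of_submod) v.

Lemma to_lquotP u v : to_lquot u = to_lquot v <-> u - v \in W.
Proof.
rewrite -[u - v \in W]/(u - v \in zmod_of_submod) Quotient.idealrBE; split; first by move=> h; apply/eqP.
by move/eqP.
Qed.

Lemma to_lquot_repr (u : lquot) : to_lquot (repr u) = u.
Proof. by rewrite /to_lquot reprK. Qed.

Lemma to_lquotD u v : to_lquot (u + v) = to_lquot u + to_lquot v.
Proof. by rewrite /to_lquot raddfD. Qed.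

Definition lquot_scale (a : F) (u : lquot) : lquot := to_lquot (a *: repr u).

Lemma lquot_scaleE a v : lquot_scale a (to_lquot v) = to_lquot (a *: v).
Proof.
apply/to_lquotP; rewrite -scalerBr; apply: rpredZ.
by apply/to_lquotP; rewrite to_lquot_repr.
Qed.

Lemma lquot_scaleA a b v :
  lquot_scale a (lquot_scale b v) = lquot_scale (a * b) v.
Proof. by rewrite -(to_lquot_repr v) !lquot_scaleE scalerA. Qed.

Lemma lquot_scale1 : left_id 1 lquot_scale.
Proof. by move=> v; rewrite -(to_lquot_repr v) lquot_scaleE scale1r. Qed.

Lemma lquot_scaleDr : right_distributive lquot_scale +%R.
Proof.
move=> a u v; rewrite -(to_lquot_repr u) -(to_lquot_repr v).
by rewrite -to_lquotD !lquot_scaleE scalerDr to_lquotD.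
Qed.

Lemma lquot_scaleDl v : {morph lquot_scale^~ v : a b / a + b}.
Proof.
by move=> a b /=; rewrite -(to_lquot_repr v) !lquot_scaleE scalerDl to_lquotD.
Qed.

HB.instance Definition _ := GRing.Zmodule_isLmodule.Build F lquot
  lquot_scaleA lquot_scale1 lquot_scaleDr lquot_scaleDl.

End QuotientLmodule.

(* [S] is a linear subspace of [V] of finite dimension [d]: it has a basis
   with [d] elements. *)
Definition has_dim (F : fieldType) (V : lmodType F) (S : set V) (d : nat) :=
  exists b : 'I_d -> V,
    S = [set v | exists c : 'I_d -> F, v = \sum_(i < d) c i *: b i] /\
    (forall c : 'I_d -> F,
       \sum_(i < d) c i *: b i = 0 -> forall i, c i = 0).

(** * Tensor products over the integers *)

Definition biadditive (A B M : zmodType) (f : A -> B -> M) :=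
  (forall a a' b, f (a + a') b = f a b + f a' b) /\
  (forall a b b', f a (b + b') = f a b + f a b').

(* [(M, f)] is the tensor product of the abelian groups [A] and [B]. *)
Definition is_tensor_product (A B M : zmodType) (f : A -> B -> M) :=
  biadditive f /\
  forall (N : zmodType) (g : A -> B -> N), biadditive g ->
    exists! h : M -> N,
      {morph h : u v / u + v} /\ (forall a b, h (f a b) = g a b).

(** * Laurent polynomials *)

Section Laurent.
Variable F : fieldType.
Local Notation "p %:F" := (@tofrac {poly F} p).

(* [F[t, t^-1]] is the subring of [F(t)] of the fractions [p / t^n]. *)
Definition laurent_pred : {pred {fraction {poly F}}} :=
  [pred x | `[< exists (p : {poly F}) (n : nat), x * ('X^n)%:F = p%:F >]].

Lemma laurent_subring_closed : subring_closed laurent_pred.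
Proof.
split=> [|x y /asboolP[p [n xE]] /asboolP[q [m yE]]
         |x y /asboolP[p [n xE]] /asboolP[q [m yE]]]; apply/asboolP.
- by exists 1, 0; rewrite expr0 mulr1.
- exists (p * 'X^m - q * 'X^n), (n + m).
  rewrite exprD tofracB !tofracM mulrBl -xE -yE.
  by rewrite mulrA [_%:F * _%:F]mulrC mulrA [y * _ * _]mulrAC.
- exists (p * q), (n + m).
  by rewrite exprD !tofracM -xE -yE mulrACA.
Qed.

Record laurent := MkLaurent {
  laurent_val : {fraction {poly F}};
  laurent_valP : laurent_val \in laurent_pred }.

HB.instance Definition _ := [isSub for laurent_val].
HB.instance Definition _ := [Choice of laurent by <:].
HB.instance Definition _ := GRing.SubChoice_isSubComNzRing.Build _ _ laurent
  laurent_subring_closed.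

Lemma laurent_poly_subproof (p : {poly F}) : p%:F \in laurent_pred.
Proof. by apply/asboolP; exists p, 0; rewrite expr0 mulr1. Qed.

Definition laurent_poly (p : {poly F}) : laurent :=
  MkLaurent (laurent_poly_subproof p).

Definition laurent_t : laurent := laurent_poly 'X.
Definition laurent_const (c : F) : laurent := laurent_poly c%:P.

(* The value [p(a) / a^n] of [p / t^n] at [a]; independent of the choice of
   [p] and [n] when [a != 0]. *)
Definition laurent_eval (x : laurent) (a : F) : F :=
  let pn := xget (0, 0)
    [set pn : {poly F} * nat | laurent_val x * ('X^(pn.2))%:F = pn.1%:F] in
  pn.1.[a] / a ^+ pn.2.

End Laurent.

(** * Finitely presented modules *)

Section OrderIdeal.
Variables (L : comNzRingType) (M : lmodType L).

(* [x] generates [M], and the rows of [P] generate the relations. *)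
Definition presents r g (P : 'M[L]_(r, g)) (x : 'I_g -> M) :=
  (forall m, exists v : 'rV[L]_g, m = \sum_(j < g) v 0 j *: x j) /\
  (forall v : 'rV[L]_g, \sum_(j < g) v 0 j *: x j = 0 <->
     exists u : 'rV[L]_r, v = u *m P).

(* The ideal generated by the [g x g] minors of a [r x g] presentation
   matrix (choices of rows with repetitions contribute 0). *)
Definition maximal_minors_ideal r g (P : 'M[L]_(r, g)) : set L :=
  [set d | exists c : {ffun 'I_g -> 'I_r} -> L,
     d = \sum_f c f * \det (rowsub f P)].

Definition principal_ideal (d : L) : set L := [set c * d | c in setT].

(* [d] generates the order ideal of [M]. *)
Definition is_order (d : L) :=
  exists r g (P : 'M[L]_(r, g)) (x : 'I_g -> M),
    presents P x /\ maximal_minors_ideal P = principal_ideal d.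

Definition primary_part (p : L) : set M :=
  [set m | exists n, p ^+ n *: m = 0].

(* [S] is isomorphic to the direct sum of the [L / (p ^ q_i)]: the [e i]
   induce a surjection from [L^k] onto [S], with kernel the direct sum of the
   ideals [(p ^ q_i)]. *)
Definition is_sum_of_cyclic (S : set M) (p : L) k (q : k.-tuple nat) :=
  exists e : 'I_k -> M,
    S = [set m | exists v : 'I_k -> L, m = \sum_(i < k) v i *: e i] /\
    (forall v : 'I_k -> L, \sum_(i < k) v i *: e i = 0 <->
       forall i, principal_ideal (p ^+ tnth q i) (v i)).

End OrderIdeal.

Arguments is_order {L} M d.
Arguments primary_part {L} M p.

(** * Alexander modules *)

Section Alexander.
Variables (G : groupType) (F : fieldType).

(* [deg] is the map [g |-> |g|], inducing the isomorphism of [G / [G, G]] with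
   the integers which sends the class of [mu] to 1. *)
Definition is_degree (mu : G) (deg : G -> int) :=
  [/\ {morph deg : x y / (x * y)%g >-> x + y},
      forall x, deg x = 0 <-> x \in derived_pred G &
      deg mu = 1].

(* [(M, tens)] is the tensor product of [G' / G''] with [F] over the integers,
   with its structure of a module over [F[t, t^-1]]. *)
Definition is_alexander_module (mu : G) (M : lmodType (laurent F))
    (tens : abelianization (derived_group G) -> F -> M) :=
  [/\ is_tensor_product tens,
      forall y z,
        laurent_t F *: tens (to_ab y) z = tens (to_ab (conj_derived mu y)) z &
      forall c a z, laurent_const c *: tens a z = tens a (c * z)].

End Alexander.

(** * Cohomology in degree 1 *)

Section Cohomology.
Variables (G : groupType) (F : fieldType) (deg : G -> int) (a : F).

Definition cocycle_pred : {pred G -> F^o} :=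
  [pred f | `[< forall x y, f (x * y)%g = f x + a ^ deg x * f y >]].

Lemma cocycle_submod_closed : subsemimod_closed cocycle_pred.
Proof.
split; first split.
- by apply/asboolP => x y; rewrite /= mulr0 addr0.
- move=> f g /asboolP hf /asboolP hg; apply/asboolP => x y.
  by rewrite !fctE hf hg mulrDr addrACA.
- move=> c f /asboolP hf; apply/asboolP => x y.
  by rewrite !fctE hf scalerDr /GRing.scale/= mulrCA.
Qed.

HB.instance Definition _ := GRing.isSubmodClosed.Build F (G -> F^o)
  cocycle_pred cocycle_submod_closed.

(* [Z^1(G, F_a)] *)
Record cocycle := Cocycle {
  cocycle_val :> G -> F^o; cocycle_valP : cocycle_val \in cocycle_pred }.

HB.instance Definition _ := [isSub for cocycle_val].
HB.instance Definition _ := [Choice of cocycle by <:].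
HB.instance Definition _ := [SubChoice_isSubLmodule of cocycle by <:].

(* [B^1(G, F_a)], as a subspace of [Z^1(G, F_a)] *)
Definition coboundary_pred : {pred cocycle} :=
  [pred U : cocycle | `[< exists b : F, forall x, U x = (a ^ deg x - 1) * b >]].

Lemma coboundary_submod_closed : subsemimod_closed coboundary_pred.
Proof.
split; first split.
- by apply/asboolP; exists 0 => x; rewrite mulr0.
- move=> f g /asboolP[b hb] /asboolP[c hc]; apply/asboolP.
  by exists (b + c) => x; rewrite mulrDr -hb -hc.
- move=> c f /asboolP[b hb]; apply/asboolP; exists (c * b) => x.
  by rewrite mulrCA -hb.
Qed.

HB.instance Definition _ := GRing.isSubmodClosed.Build F cocycle
  coboundary_pred coboundary_submod_closed.

(* [H^1(G, F_a)] *)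
Definition cohomology := lquot coboundary_pred.
HB.instance Definition _ := GRing.Lmodule.on cohomology.

Definition cohomology_class (U : cocycle) : cohomology :=
  to_lquot coboundary_pred U.

End Cohomology.

(** * The representations [rho_n^V] and the spaces [C_n] *)

Section Representations.
Variables (G : groupType) (F : fieldType) (deg : G -> int) (a : F).

Definition nilpotent_shift m : 'M[F]_m :=
  \matrix_(i, j) (j == i.+1 :> nat)%:R.

(* [phi_m] for [m = k.+1]; [^] is the power with exponent in [int]. *)
Definition phi k (x : G) : 'M[F]_k.+1 := (1 + nilpotent_shift k.+1) ^ deg x.

(* [rho_n^V] for [n = k.+2] *)
Definition rho k (V : 'I_k.+1 -> G -> F) (x : G) : 'M[F]_(1 + k.+1) :=
  block_mx (a ^ deg x)%:M (\row_j V j x) 0 (phi k x).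

(* [C_n], for [n >= 2]. The values of [rho] are always invertible and upper
   triangular, so that only multiplicativity is required. *)
Definition Cbar (n : nat) : set (cohomology deg a) :=
  [set cohomology_class U | U in [set U : cocycle deg a |
     exists V : 'I_(n - 2).+1 -> G -> F,
       V ord0 = U /\ {morph rho V : x y / (x * y)%g >-> x *m y}]].

End Representations.

Arguments Cbar {G F} deg a n.

(** * Fundamental groups *)

Lemma within_continuous_comp (U V W : topologicalType) (A : set U) (B : set V)
    (f : U -> V) (g : V -> W) :
  {within A, continuous f} -> f @` A `<=` B -> {within B, continuous g} ->
  {within A, continuous (g \o f)}.
Proof.
move=> /subspace_continuousP fc fAB /subspace_continuousP gc.
apply/subspace_continuousP => x Ax.
have Bfx : B (f x) by apply: fAB; exists x.
move=> P /= /(gc _ Bfx) /= gP.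
have := fc _ Ax _ gP; rewrite /= /within/= !nbhs_simpl/=.
by apply: filterS => y h Ay; apply: h => //; apply: fAB; exists y.
Qed.

Lemma continuous_pair (U V W : topologicalType) (f : U -> V) (g : U -> W) :
  continuous f -> continuous g -> continuous (fun p => (f p, g p)).
Proof. by move=> cf cg p; apply: cvg_pair; [exact: cf|exact: cg]. Qed.

Section RealContinuity.
Variable R : realType.
Implicit Types f g : R -> R.

Lemma continuous_max_fun f g : continuous f -> continuous g ->
  continuous (fun t => Num.max (f t) (g t)).
Proof. by move=> cf cg t; exact: (continuous_max (cf t) (cg t)). Qed.

Lemma continuous_min_fun f g : continuous f -> continuous g ->
  continuous (fun t => Num.min (f t) (g t)).
Proof. by move=> cf cg t; exact: (continuous_min (cf t) (cg t)). Qed.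

Lemma continuous_affine (a b : R) : continuous (fun t : R => a * t + b).
Proof.
move=> t; apply: cvgD; last exact: cvg_cst.
by apply: cvgM; [exact: cvg_cst|exact: cvg_id].
Qed.

End RealContinuity.

Section Homotopy.
Variables (R : realType) (T : topologicalType) (A : set T).
Local Notation I := (`[0, 1]%classic : set R).

Definition is_path (x y : T) (f : R -> T) :=
  [/\ {within I, continuous f}, f @` I `<=` A, f 0 = x & f 1 = y].

(* Concatenation and reversal of paths; only the values on [0, 1] matter. *)
Definition path_cat (f g : R -> T) (t : R) : T :=
  if t <= 2^-1 then f (2 * t) else g (2 * t - 1).
Definition path_rev (f : R -> T) (t : R) : T := f (1 - t).

(* Homotopy in [A], relative to the end points, of paths from [x] to [y]. *)
Definition path_homotopic (x y : T) (f g : R -> T) :=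
  exists H : R * R -> T,
    [/\ {within I `*` I, continuous H},
        H @` (I `*` I) `<=` A,
        {in I, forall t, H (0, t) = f t /\ H (1, t) = g t} &
        {in I, forall s, H (s, 0) = x /\ H (s, 1) = y}].

Implicit Types (x y z : T) (f g h : R -> T) (p : R * R).

Lemma unitI (t : R) : I t = (0 <= t <= 1).
Proof. by rewrite /= in_itv. Qed.

Lemma unit_in (t : R) : (t \in I) = (0 <= t <= 1).
Proof. by apply/idP/idP; rewrite -unitI; [move/set_mem|move/mem_set]. Qed.

Lemma closed_le_fun (U : topologicalType) (u v : U -> R) :
  continuous u -> continuous v -> closed [set q | u q <= v q].
Proof.
move=> cu cv; have -> : [set q | u q <= v q] = (v \- u) @^-1` [set r | 0 <= r].
  by apply/seteqP; split=> q /=; rewrite subr_ge0.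
apply: closed_comp; last exact: closed_ge.
by move=> q _; apply: cvgB; [exact: cv|exact: cu].
Qed.

Lemma closed_unit_square : closed (I `*` I).
Proof.
have -> : I `*` I = fst @^-1` I `&` snd @^-1` I by [].
by apply: closedI; (apply: closed_comp; last exact: interval_closed) => p _;
  [exact: cvg_fst|exact: cvg_snd].
Qed.

(* Pasting of two maps along the closed sets [u <= v] and [v <= u]. *)
Lemma paste (U : topologicalType) (B : set U) (u v : U -> R) (F G : U -> T) :
  closed B -> continuous u -> continuous v ->
  {within B `&` [set q | u q <= v q], continuous F} ->
  {within B `&` [set q | v q <= u q], continuous G} ->
  (forall q, B q -> u q = v q -> F q = G q) ->
  {within B, continuous (fun q => if u q <= v q then F q else G q)}.
Proof.
move=> cB cu cv cF cG FG; set k := (k in {within B, continuous k}).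
have -> : B = (B `&` [set q | u q <= v q]) `|` (B `&` [set q | v q <= u q]).
  apply/seteqP; split=> [q Bq|q [[]|[]]//].
  by have [|/ltW] := leP (u q) (v q); [left|right].
apply: withinU_continuous.
- by apply: closedI => //; exact: closed_le_fun.
- by apply: closedI => //; exact: closed_le_fun.
- apply: (subspace_eq_continuous _ cF) => q /set_mem[_ /= uv].
  by rewrite /from_subspace /k uv.
- apply: (subspace_eq_continuous _ cG) => q /set_mem[Bq /= vu].
  rewrite /from_subspace /k; case: ifP => // uv; rewrite FG//.
  by apply/eqP; rewrite eq_le uv.
Qed.

Lemma path_homotopic_refl x y f : is_path x y f -> path_homotopic x y f f.
Proof.
move=> [fc fA f0 f1]; exists (f \o snd); split.
- apply: (@within_continuous_comp _ _ _ _ I) => //.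
    by apply: continuous_subspaceT => p; exact: cvg_snd.
  by move=> _ [p [_ +] <-].
- by move=> _ [p [_ p2] <-]; apply: fA; exists p.2.
- by move=> t _.
- by move=> s _.
Qed.

Lemma path_homotopic_sym x y f g :
  path_homotopic x y f g -> path_homotopic x y g f.
Proof.
move=> [H [Hc HA Ht Hs]]; exists (H \o (fun p => (1 - p.1, p.2))).
have sub : (fun p => (1 - p.1, p.2)) @` (I `*` I) `<=` I `*` I.
  move=> _ [[s t] [/= + +] <-]; rewrite !in_itv/= => s01 t01.
  by split; rewrite /= ?in_itv/=; lra.
split.
- apply: (@within_continuous_comp _ _ _ _ (I `*` I)) => //.
  apply/continuous_subspaceT/continuous_pair => p; last exact: cvg_snd.
  by apply: cvgB; [exact: cvg_cst|exact: cvg_fst].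
- move=> _ [p pI <-]; apply: HA; exists (1 - p.1, p.2) => //.
  by apply: sub; exists p.
- by move=> t tI /=; rewrite subr0 subrr; have [-> ->] := Ht t tI.
- move=> s; rewrite unit_in => sI /=; apply: Hs.
  by rewrite unit_in; lra.
Qed.

Lemma path_homotopic_trans x y f g h : path_homotopic x y f g ->
  path_homotopic x y g h -> path_homotopic x y f h.
Proof.
move=> [H [Hc HA Ht Hs]] [K [Kc KA Kt Ks]].
exists (fun p => if p.1 <= 2^-1 then H (2 * p.1, p.2)
                 else K (2 * p.1 - 1, p.2)).
have c1 : continuous (fun p : R * R => 2 * p.1).
  by move=> p; apply: cvgM; [exact: cvg_cst|exact: cvg_fst].
split.
- apply: (@paste _ _ (fun p : R * R => p.1) (fun=> 2^-1)
    (fun p => H (2 * p.1, p.2)) (fun p => K (2 * p.1 - 1, p.2))).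
  + exact: closed_unit_square.
  + by move=> p; exact: cvg_fst.
  + by move=> p; exact: cvg_cst.
  + apply: (@within_continuous_comp _ _ _ _ (I `*` I)
      (fun p => (2 * p.1, p.2)) H) => //.
      apply/continuous_subspaceT/continuous_pair => //.
      by move=> p; exact: cvg_snd.
    move=> _ [[s t] [[/= + +] +] <-]; rewrite !in_itv/= => s01 t01 s2.
    by split; rewrite /= ?in_itv/=; lra.
  + apply: (@within_continuous_comp _ _ _ _ (I `*` I)
      (fun p => (2 * p.1 - 1, p.2)) K) => //.
      apply/continuous_subspaceT/continuous_pair => p; last exact: cvg_snd.
      by apply: cvgB; [exact: c1|exact: cvg_cst].
    move=> _ [[s t] [[/= + +] +] <-]; rewrite !in_itv/= => s01 t01 s2.
    by split; rewrite /= ?in_itv/=; lra.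
  + move=> [s t] [/= _ tI] ->; rewrite divff// subrr.
    have tI' : t \in I by exact: mem_set.
    by have [_ ->] := Ht _ tI'; have [-> _] := Kt _ tI'.
- move=> _ [[s t] [/= + +] <-]; rewrite !in_itv/= => s01 t01.
  have [s2|s2] := leP s 2^-1; [apply: HA|apply: KA].
    by exists (2 * s, t) => //; split; rewrite /= ?in_itv/=; lra.
  by exists (2 * s - 1, t) => //; split; rewrite /= ?in_itv/=; lra.
- move=> t tI /=; rewrite mulr0 invr_ge0 ler0n.
  have -> : (1 <= 2^-1 :> R) = false by apply/negbTE; rewrite -ltNge; lra.
  have -> : 2 * 1 - 1 = 1 :> R by ring.
  by have [-> _] := Ht _ tI; have [_ ->] := Kt _ tI.
- move=> s; rewrite unit_in => s01 /=; have [s2|s2] := leP s 2^-1.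
    by apply: Hs; rewrite unit_in; lra.
  by apply: Ks; rewrite unit_in; lra.
Qed.

Lemma is_path_cat x y z f g :
  is_path x y f -> is_path y z g -> is_path x z (path_cat f g).
Proof.
move=> [fc fA f0 f1] [gc gA g0 g1]; rewrite /path_cat.
have c1 : continuous (fun t : R => 2 * t).
  by move=> t; apply: cvgM; [exact: cvg_cst|exact: cvg_id].
split.
- apply: (@paste R _ id (fun=> 2^-1) (fun t => f (2 * t))
    (fun t => g (2 * t - 1))).
  + exact: interval_closed.
  + by move=> t; exact: cvg_id.
  + by move=> t; exact: cvg_cst.
  + apply: (@within_continuous_comp R R _ _ I (fun t => 2 * t) f) => //.
      exact: continuous_subspaceT.
    by move=> _ [t [/= + +] <-]; rewrite !in_itv/=; lra.
  + apply: (@within_continuous_comp R R _ _ I (fun t => 2 * t - 1) g) => //.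
      apply: continuous_subspaceT => t.
      by apply: cvgB; [exact: c1|exact: cvg_cst].
    by move=> _ [t [/= + +] <-]; rewrite !in_itv/=; lra.
  + by move=> t _ ->; rewrite divff// subrr f1 g0.
- move=> _ [t /= + <-]; rewrite ?in_itv/= => t01.
  have [t2|t2] := leP t 2^-1; [apply: fA|apply: gA].
    by exists (2 * t) => //; rewrite /= ?in_itv/=; lra.
  by exists (2 * t - 1) => //; rewrite /= ?in_itv/=; lra.
- by rewrite mulr0 invr_ge0 ler0n.
- have -> : (1 <= 2^-1 :> R) = false by apply/negbTE; rewrite -ltNge; lra.
  by have -> : 2 * 1 - 1 = 1 :> R by ring.
Qed.

Lemma path_cat_homotopic x y z f f' g g' :
  path_homotopic x y f f' -> path_homotopic y z g g' ->
  path_homotopic x z (path_cat f g) (path_cat f' g').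
Proof.
move=> [H [Hc HA Ht Hs]] [K [Kc KA Kt Ks]].
exists (fun p => if p.2 <= 2^-1 then H (p.1, 2 * p.2)
                 else K (p.1, 2 * p.2 - 1)).
have c1 : continuous (fun p : R * R => 2 * p.2).
  by move=> p; apply: cvgM; [exact: cvg_cst|exact: cvg_snd].
split.
- apply: (@paste _ _ (fun p : R * R => p.2) (fun=> 2^-1)
    (fun p => H (p.1, 2 * p.2)) (fun p => K (p.1, 2 * p.2 - 1))).
  + exact: closed_unit_square.
  + by move=> p; exact: cvg_snd.
  + by move=> p; exact: cvg_cst.
  + apply: (@within_continuous_comp _ _ _ _ (I `*` I)
      (fun p => (p.1, 2 * p.2)) H) => //.
      apply/continuous_subspaceT/continuous_pair => //.
      by move=> p; exact: cvg_fst.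
    move=> _ [[s t] [[/= + +] +] <-]; rewrite !in_itv/= => s01 t01 s2.
    by split; rewrite /= ?in_itv/=; lra.
  + apply: (@within_continuous_comp _ _ _ _ (I `*` I)
      (fun p => (p.1, 2 * p.2 - 1)) K) => //.
      apply/continuous_subspaceT/continuous_pair => p; first exact: cvg_fst.
      by apply: cvgB; [exact: c1|exact: cvg_cst].
    move=> _ [[s t] [[/= + +] +] <-]; rewrite !in_itv/= => s01 t01 s2.
    by split; rewrite /= ?in_itv/=; lra.
  + move=> [s t] [/= sI _] ->; rewrite divff// subrr.
    have sI' : s \in I by exact: mem_set.
    by have [_ ->] := Hs _ sI'; have [-> _] := Ks _ sI'.
- move=> _ [[s t] [/= + +] <-]; rewrite !in_itv/= => s01 t01.
  have [t2|t2] := leP t 2^-1; [apply: HA|apply: KA].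
    by exists (s, 2 * t) => //; split; rewrite /= ?in_itv/=; lra.
  by exists (s, 2 * t - 1) => //; split; rewrite /= ?in_itv/=; lra.
- move=> t; rewrite unit_in => t01 /=; rewrite /path_cat; have [t2|t2] := leP t 2^-1.
    by apply: Ht; rewrite unit_in; lra.
  by apply: Kt; rewrite unit_in; lra.
- move=> s sI /=; rewrite mulr0 invr_ge0 ler0n.
  have -> : (1 <= 2^-1 :> R) = false by apply/negbTE; rewrite -ltNge; lra.
  have -> : 2 * 1 - 1 = 1 :> R by ring.
  by have [-> _] := Hs _ sI; have [_ ->] := Ks _ sI.
Qed.

Lemma is_path_rev x y f : is_path x y f -> is_path y x (path_rev f).
Proof.
move=> [fc fA f0 f1]; rewrite /path_rev.
have sub : (fun t : R => 1 - t) @` I `<=` I.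
  by move=> _ [t /= + <-]; rewrite !in_itv/=; lra.
split; rewrite ?subr0 ?subrr//.
- apply: (@within_continuous_comp R R _ _ I (fun t => 1 - t) f) => //.
  apply: continuous_subspaceT => t.
  by apply: cvgB; [exact: cvg_cst|exact: cvg_id].
- by move=> _ [t tI <-]; apply: fA; exists (1 - t) => //; apply: sub; exists t.
Qed.

Lemma path_rev_homotopic x y f g : path_homotopic x y f g ->
  path_homotopic y x (path_rev f) (path_rev g).
Proof.
move=> [H [Hc HA Ht Hs]]; exists (H \o (fun p => (p.1, 1 - p.2))).
have sub : (fun p => (p.1, 1 - p.2)) @` (I `*` I) `<=` I `*` I.
  move=> _ [[s t] [/= + +] <-]; rewrite !in_itv/= => s01 t01.
  by split; rewrite /= ?in_itv/=; lra.
split.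
- apply: (@within_continuous_comp _ _ _ _ (I `*` I)) => //.
  apply/continuous_subspaceT/continuous_pair => p; first exact: cvg_fst.
  by apply: cvgB; [exact: cvg_cst|exact: cvg_snd].
- move=> _ [p pI <-]; apply: HA; exists (p.1, 1 - p.2) => //.
  by apply: sub; exists p.
- move=> t; rewrite unit_in => tI /=; apply: Ht.
  by rewrite unit_in; lra.
- by move=> s sI /=; rewrite subr0 subrr; have [-> ->] := Hs s sI.
Qed.

Lemma path_homotopic_eq x y f g : is_path x y f -> is_path x y g ->
  {in I, f =1 g} -> path_homotopic x y f g.
Proof.
move=> fp [_ _ g0 g1] fg; have [H [Hc HA Ht Hs]] := path_homotopic_refl fp.
exists H; split=> // t tI; have [-> ->] := Ht t tI.
by rewrite fg.
Qed.

(* Two reparametrizations of the same path are homotopic. *)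
Lemma path_homotopic_reparam x y a b f (u v : R -> R) : is_path a b f ->
  continuous u -> continuous v ->
  (forall t, 0 <= t <= 1 -> 0 <= u t <= 1) ->
  (forall t, 0 <= t <= 1 -> 0 <= v t <= 1) ->
  u 0 = v 0 -> u 1 = v 1 -> f (u 0) = x -> f (u 1) = y ->
  path_homotopic x y (f \o u) (f \o v).
Proof.
move=> [fc fA _ _] cu cv uI vI uv0 uv1 f0 f1.
pose k (p : R * R) := u p.2 + p.1 * (v p.2 - u p.2).
have kI : k @` (I `*` I) `<=` I.
  move=> _ [[s t] [/= + +] <-]; rewrite /k !in_itv/= => s01 t01.
  by have := uI t t01; have := vI t t01; nra.
exists (f \o k); split.
- apply: (within_continuous_comp _ kI fc).
  apply: continuous_subspaceT => p.
  have c2 (w : R -> R) : continuous w -> w \o snd @ p --> w p.2.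
    by move=> cw; apply: continuous_comp; [exact: cvg_snd|exact: cw].
  apply: cvgD; first exact: c2.
  by apply: cvgM; [exact: cvg_fst|apply: cvgB; exact: c2].
- by move=> _ [p pI <-]; apply: fA; exists (k p) => //; apply: kI; exists p.
- by move=> t _; rewrite /k /= mul0r addr0 mul1r addrC subrK.
- by move=> s _; rewrite /k /= -uv0 -uv1 !subrr !mulr0 !addr0.
Qed.

Lemma path_reparam x y a b f (u : R -> R) : is_path a b f -> continuous u ->
  (forall t, 0 <= t <= 1 -> 0 <= u t <= 1) -> f (u 0) = x -> f (u 1) = y ->
  is_path x y (f \o u).
Proof.
move=> [fc fA _ _] cu uI f0 f1; have sub : u @` I `<=` I.
  by move=> _ [t /= + <-]; rewrite !in_itv/=; exact: uI.
split=> //; first by apply: (within_continuous_comp _ sub fc); exact: continuous_subspaceT.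
by move=> _ [t tI <-]; apply: fA; exists (u t) => //; apply: sub; exists t.
Qed.

Lemma is_path_cst x : A x -> is_path x x (fun=> x).
Proof.
move=> Ax; split=> //; last by move=> _ [t _ <-].
by apply: continuous_subspaceT => t; exact: cvg_cst.
Qed.

(* [h] agrees on [0, 1] with the reparametrization [f \o u]. *)
Lemma path_homotopic_reparam_eq x y f h (u : R -> R) :
  is_path x y f -> is_path x y h -> continuous u ->
  (forall t, 0 <= t <= 1 -> 0 <= u t <= 1) -> u 0 = 0 -> u 1 = 1 ->
  (forall t, 0 <= t <= 1 -> h t = f (u t)) ->
  path_homotopic x y h f.
Proof.
move=> fp hp cu uI u0 u1 hfu; have [_ _ f0 f1] := fp.
have fup : is_path x y (f \o u) by apply: path_reparam fp _ _ _ _; rewrite ?u0 ?u1.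
apply: (@path_homotopic_trans _ _ _ (f \o u)).
  by apply: path_homotopic_eq => // t; rewrite unit_in => /hfu.
apply: (path_homotopic_reparam (v := id) fp) => //; rewrite ?u0 ?u1//.
by move=> t; exact: cvg_id.
Qed.

Lemma path_catA x y z w f g h :
  is_path x y f -> is_path y z g -> is_path z w h ->
  path_homotopic x w (path_cat f (path_cat g h)) (path_cat (path_cat f g) h).
Proof.
move=> fp gp hp.
have p1 := is_path_cat fp (is_path_cat gp hp).
have p2 := is_path_cat (is_path_cat fp gp) hp.
pose u (t : R) := Num.max (t / 2) (Num.max (t - 4^-1) (2 * t - 1)).
have uP t r : t / 2 <= r -> t - 4^-1 <= r -> 2 * t - 1 <= r ->
    [|| r == t / 2, r == t - 4^-1 | r == 2 * t - 1] -> u t = r.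
  move=> r1 r2 r3 rE; apply/eqP; rewrite eq_le /u !ge_max r1 r2 r3 !le_max /=.
  by case/or3P: rE => /eqP->; rewrite lexx ?orbT.
apply: (path_homotopic_reparam_eq (u := u) p2 p1).
- apply: continuous_max_fun; last apply: continuous_max_fun.
  + by move=> t; apply: cvgM; [exact: cvg_id|exact: cvg_cst].
  + by move=> t; apply: cvgB; [exact: cvg_id|exact: cvg_cst].
  + exact: continuous_affine.
- move=> t t01; rewrite /u !le_max !ge_max; apply/andP; split.
    by apply/orP; left; lra.
  by apply/and3P; split; lra.
- by apply: uP; rewrite ?mul0r ?eqxx//; lra.
- by apply: uP; try lra; apply/or3P; apply: Or33; apply/eqP; lra.
- move=> t t01; have [_ _ f0 f1] := fp; have [_ _ g0 g1] := gp.
  have [_ _ h0 h1] := hp; rewrite /path_cat.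
  have [t1|t1] := leP t 2^-1.
    have -> : u t = t / 2 by apply: uP; rewrite ?eqxx ?orbT//; lra.
    have -> : t / 2 <= 2^-1 by lra.
    have -> : 2 * (t / 2) = t by field.
    by rewrite t1.
  have [t2|t2] := leP (2 * t - 1) 2^-1.
    have -> : u t = t - 4^-1 by apply: uP; rewrite ?eqxx ?orbT//; lra.
    have -> : t - 4^-1 <= 2^-1 by lra.
    have -> : (2 * (t - 4^-1) <= 2^-1) = false.
      by apply/negbTE; rewrite -ltNge; lra.
    by congr g; field.
  have -> : u t = 2 * t - 1 by apply: uP; rewrite ?eqxx ?orbT//; lra.
  have -> : (2 * t - 1 <= 2^-1) = false by apply/negbTE; rewrite -ltNge.
  by [].
Qed.

Lemma path_cat1p x y f : is_path x y f ->
  path_homotopic x y (path_cat (fun=> x) f) f.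
Proof.
move=> fp; have [_ fA f0 f1] := fp.
have Ax : A x by rewrite -f0; apply: fA; exists 0 => //; rewrite /= ?in_itv/=; lra.
pose u (t : R) := Num.max 0 (2 * t - 1).
apply: (path_homotopic_reparam_eq (u := u) fp).
- exact: is_path_cat (is_path_cst Ax) fp.
- apply: continuous_max_fun; last exact: continuous_affine.
  by move=> t; exact: cvg_cst.
- by move=> t t01; rewrite /u; have [?|?] := ltP 0 (2 * t - 1); lra.
- by rewrite /u; have [?|?] := ltP 0 (2 * 0 - 1 : R); lra.
- by rewrite /u; have [?|?] := ltP 0 (2 * 1 - 1 : R); lra.
- move=> t t01; rewrite /path_cat /u; have [t1|t1] := leP t 2^-1.
    have -> : Num.max 0 (2 * t - 1) = 0 by have [?|?] := ltP 0 (2 * t - 1); lra.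
    by rewrite f0.
  by have -> : Num.max 0 (2 * t - 1) = 2 * t - 1
    by have [?|?] := ltP 0 (2 * t - 1); lra.
Qed.

Lemma path_catp1 x y f : is_path x y f ->
  path_homotopic x y (path_cat f (fun=> y)) f.
Proof.
move=> fp; have [_ fA f0 f1] := fp.
have Ay : A y by rewrite -f1; apply: fA; exists 1 => //; rewrite /= ?in_itv/=; lra.
pose u (t : R) := Num.min 1 (2 * t).
apply: (path_homotopic_reparam_eq (u := u) fp).
- exact: is_path_cat fp (is_path_cst Ay).
- apply: continuous_min_fun; first by move=> t; exact: cvg_cst.
  by move=> t; apply: cvgM; [exact: cvg_cst|exact: cvg_id].
- by move=> t t01; rewrite /u; have [?|?] := ltP 1 (2 * t); lra.
- by rewrite /u; have [?|?] := ltP 1 (2 * 0 : R); lra.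
- by rewrite /u; have [?|?] := ltP 1 (2 * 1 : R); lra.
- move=> t t01; rewrite /path_cat /u; have [t1|t1] := leP t 2^-1.
    by have -> : Num.min 1 (2 * t) = 2 * t by have [?|?] := ltP 1 (2 * t); lra.
  have -> : Num.min 1 (2 * t) = 1 by have [?|?] := ltP 1 (2 * t); lra.
  by rewrite f1.
Qed.

Lemma path_catpV x y f : is_path x y f ->
  path_homotopic x x (path_cat f (path_rev f)) (fun=> x).
Proof.
move=> fp; have [_ fA f0 f1] := fp.
pose u (t : R) := Num.min (2 * t) (2 - 2 * t).
have c1 : continuous (fun t : R => 2 * t).
  by move=> t; apply: cvgM; [exact: cvg_cst|exact: cvg_id].
have cu : continuous u.
  apply: continuous_min_fun => // t.
  by apply: cvgB; [exact: cvg_cst|exact: c1].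
have uI t : 0 <= t <= 1 -> 0 <= u t <= 1.
  by move=> t01; rewrite /u; have [?|?] := ltP (2 * t) (2 - 2 * t); lra.
have u0 : u 0 = 0.
  by rewrite /u; have [?|?] := ltP (2 * 0) (2 - 2 * 0 : R); lra.
have u1 : u 1 = 0.
  by rewrite /u; have [?|?] := ltP (2 * 1) (2 - 2 * 1 : R); lra.
have fup : is_path x x (f \o u) by apply: (path_reparam fp); rewrite ?u0 ?u1.
apply: (@path_homotopic_trans _ _ _ (f \o u)).
  apply: path_homotopic_eq => //; first exact: is_path_cat fp (is_path_rev fp).
  move=> t; rewrite unit_in => t01; rewrite /path_cat /path_rev /u /=.
  by have [t1|t1] := leP t 2^-1; congr f;
    have [?|?] := ltP (2 * t) (2 - 2 * t); lra.
have -> : (fun=> x) = f \o (fun=> 0) :> (R -> T) by apply: funext => t /=.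
apply: (path_homotopic_reparam fp) => //; rewrite ?u0 ?u1//.
  by move=> t; exact: cvg_cst.
by move=> t _; lra.
Qed.

Lemma path_catVp x y f : is_path x y f ->
  path_homotopic y y (path_cat (path_rev f) f) (fun=> y).
Proof.
move=> fp; have := path_catpV (is_path_rev fp).
by congr path_homotopic; congr path_cat; apply/funext => t;
  rewrite /path_rev opprB addrC subrK.
Qed.

End Homotopy.

Section FundamentalGroup.
Variables (R : realType) (T : topologicalType) (A : set T) (x0 : A).
Local Notation b := (set_val x0).

Record loop := Loop { loop_val :> R -> T; loopP : is_path A b b loop_val }.

HB.instance Definition _ := gen_eqMixin loop.
HB.instance Definition _ := gen_choiceMixin loop.

Definition loop_equiv (f g : loop) : bool := `[< path_homotopic A b b f g >].

Lemma loop_equiv_class : equiv_class_of loop_equiv.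
Proof.
split=> [f|f g|g f h].
- by apply/asboolP; apply: path_homotopic_refl; exact: loopP.
- by apply/asboolP/asboolP; exact: path_homotopic_sym.
- by move=> /asboolP fg /asboolP gh; apply/asboolP;
    exact: path_homotopic_trans fg gh.
Qed.

Canonical loop_equiv_rel := EquivRelPack loop_equiv_class.

(* The fundamental group of the subspace [A] of [T] at [x0]. *)
Definition pi1 := {eq_quot loop_equiv_rel}.
HB.instance Definition _ := Choice.on pi1.

Definition loop_class (f : loop) : pi1 := \pi_pi1 f.

Lemma loop_classP f g :
  loop_class f = loop_class g <-> path_homotopic A b b f g.
Proof.
split; first by move/eqP; rewrite eqmodE => /asboolP.
by move=> h; apply/eqP; rewrite eqmodE; apply/asboolP.
Qed.

Lemma loop_class_repr (u : pi1) : loop_class (repr u) = u.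
Proof. by rewrite /loop_class reprK. Qed.

Definition loop_cat (f g : loop) := Loop (is_path_cat (loopP f) (loopP g)).
Definition loop_rev (f : loop) := Loop (is_path_rev (loopP f)).
Definition loop_cst := Loop (is_path_cst R (set_valP x0)).

Definition pi1_one := loop_class loop_cst.
Definition pi1_mul (u v : pi1) := loop_class (loop_cat (repr u) (repr v)).
Definition pi1_inv (u : pi1) := loop_class (loop_rev (repr u)).

Lemma pi1_mulE f g :
  pi1_mul (loop_class f) (loop_class g) = loop_class (loop_cat f g).
Proof.
by apply/loop_classP/path_cat_homotopic; apply/loop_classP;
  rewrite loop_class_repr.
Qed.

Lemma pi1_invE f : pi1_inv (loop_class f) = loop_class (loop_rev f).
Proof.
by apply/loop_classP/path_rev_homotopic; apply/loop_classP;
  rewrite loop_class_repr.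
Qed.

Lemma pi1_mulA : associative pi1_mul.
Proof.
move=> u v w; rewrite -(loop_class_repr u) -(loop_class_repr v).
rewrite -(loop_class_repr w) !pi1_mulE; apply/loop_classP.
by apply: path_catA; exact: loopP.
Qed.

Lemma pi1_mul1g : left_id pi1_one pi1_mul.
Proof.
move=> u; rewrite -(loop_class_repr u) pi1_mulE; apply/loop_classP.
by apply: path_cat1p; exact: loopP.
Qed.

Lemma pi1_mulg1 : right_id pi1_one pi1_mul.
Proof.
move=> u; rewrite -(loop_class_repr u) pi1_mulE; apply/loop_classP.
by apply: path_catp1; exact: loopP.
Qed.

Lemma pi1_mulVg : left_inverse pi1_one pi1_inv pi1_mul.
Proof.
move=> u; rewrite -(loop_class_repr u) pi1_invE pi1_mulE; apply/loop_classP.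
by apply: path_catVp (loopP _).
Qed.

Lemma pi1_mulgV : right_inverse pi1_one pi1_inv pi1_mul.
Proof.
move=> u; rewrite -(loop_class_repr u) pi1_invE pi1_mulE; apply/loop_classP.
by apply: path_catpV (loopP _).
Qed.

HB.instance Definition _ :=
  isGroup.Build pi1 pi1_mulA pi1_mul1g pi1_mulg1 pi1_mulVg pi1_mulgV.

End FundamentalGroup.

Arguments pi1 R {T A} x0.

(** * Knots *)

(* [f] restricts to a homeomorphism from [A] onto its image. *)
Definition is_embedding (U V : topologicalType) (A : set U) (f : U -> V) :=
  {within A, continuous f} /\
  exists g : V -> U, {within f @` A, continuous g} /\ {in A, cancel f g}.

Section Knots.
Variable R : realType.

Definition sphere3 : set 'rV[R]_4 := [set x | \sum_i x 0 i ^+ 2 = 1].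
Definition circle : set (R * R) := [set z | z.1 ^+ 2 + z.2 ^+ 2 = 1].
Definition disk : set (R * R) := [set z | z.1 ^+ 2 + z.2 ^+ 2 <= 1].

Definition is_knot (K : set 'rV[R]_4) :=
  K `<=` sphere3 /\
  exists f : R * R -> 'rV[R]_4, is_embedding circle f /\ f @` circle = K.

(* [E] is an embedding in the sphere of the open solid torus, with core [K]. A
   closed tubular neighbourhood is the image of [circle `*` disk] by such a
   map: the collar given by [E] prevents its boundary from being wild. Only
   tame knots have one. *)
Definition tubular_embedding (K : set 'rV[R]_4)
    (E : (R * R) * (R * R) -> 'rV[R]_4) :=
  [/\ is_embedding (circle `*` setT) E,
      E @` (circle `*` setT) `<=` sphere3 &
      E @` (circle `*` [set (0, 0)]) = K].

Definition tubular_nbhd (E : (R * R) * (R * R) -> 'rV[R]_4) :=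
  E @` (circle `*` disk).

Definition exterior (E : (R * R) * (R * R) -> 'rV[R]_4) : set 'rV[R]_4 :=
  closure (sphere3 `\` tubular_nbhd E).

(* The boundary of the disk fibre over [z]; both orientations of the meridians
   occur, as [E] may be composed with a reflection of the fibres. *)
Definition fibre_boundary (E : (R * R) * (R * R) -> 'rV[R]_4) (z : R * R)
    (t : R) : 'rV[R]_4 :=
  E (z, (cos (2 * pi * t), sin (2 * pi * t))).

(* [mu] is represented by [c * m * c^-1], with [m] the boundary of a fibre and
   [c] a path in the exterior from [x0] to the base point of [m]. *)
Definition is_meridian (E : (R * R) * (R * R) -> 'rV[R]_4) (x0 : exterior E)
    (mu : pi1 R x0) :=
  exists (z : R * R) (c : R -> 'rV[R]_4) (l : loop R x0),
    [/\ circle z,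
        is_path (exterior E) (set_val x0) (fibre_boundary E z 0) c,
        {in `[0, 1], l =1
           path_cat c (path_cat (fibre_boundary E z) (path_rev c))} &
        mu = loop_class l].

End Knots.

(* Main.v *)
From HB Require Import structures.
Require Import Defs.
From mathcomp Require Import all_boot all_order all_algebra complex.
From mathcomp Require Import fraction ring_quotient ring.
From mathcomp Require Import all_classical all_reals all_analysis.

Set Implicit Arguments.
Unset Strict Implicit.
Unset Printing Implicit Defensive.

Import Order.TTheory GRing.Theory Num.Theory.
Import numFieldNormedType.Exports.
Local Open Scope classical_set_scope.
Local Open Scope ring_scope.

(** Everything happens in the Alexander module [M] over the ring of Laurent
polynomials in [t]; write [s = t - a] with [a] the chosen root. The argument is
algebraic and is carried out for a group [G] with infinite cyclic
abelianization, over a field [F].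

Let [J = 1 + N] be the unipotent Jordan block of size [m = n - 1]. The map
[rho_n^V] is multiplicative exactly when the row [V] satisfies
[V (x y) = a^|x| V(y) + V(x) J^|y|] ([rho_morph_row_cocycle]). On the derived
group such a [V] is additive, and conjugation by [mu] multiplies its values on
the right by [A = a J^-1]; hence [V] is the same as a map [h] from [M] to row
vectors for which [t] acts as [A] ([row_cocycle_extends]), and every such map
comes from a [V] ([row_cocycle_of_extension]). For [m = 1] these maps are the
functionals [h] with [h (t m) = a h(m)]. Since [a != 1], a cocycle that vanishes
on the derived group is a coboundary ([cocycle_vanish_coboundary]), so that
[H^1] is the space of these functionals; in general the first coordinate of [h]
is the functional of [v_1].

The abelianization of [G] being cyclic, [M = (t - 1) M]
([alexander_divisible]). Let [c] be a scalar such that [M = (t - c) M]. The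
determinant trick gives an element [1 - (t - c) y] of the order ideal that
kills [M] ([order_of_divisible]), and its value at [c] is [1], hence
[Delta(c) != 0]. With [c = 1] this shows that [a != 1], and that [M] is killed
by a nonzero polynomial [s^i g] with [g(a) != 0], so [g M] is contained in the
primary part ([primary_projection]). With [c = a] it shows that the primary
part is not zero ([cyclic_summands_exist]).

A functional is thus determined by its values [c_i] at the generators [e_i] of
the primary part. The matrix [A - a] is, up to a factor commuting with [N], the
nilpotent block [N]: its [m]-th power vanishes, and a row killed by a smaller
power has first coordinate [0] ([jordan_inv_nilp], [jordan_inv_ker]). As
[s^q_i e_i = 0], the value [c_i] must vanish when [q_i < m]; conversely any
values [c_i] supported on the indices with [q_i >= m] come from a row-valued map
([row_cocycle_realize]). So in the basis of [H^1] dual to the [e_i], the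
subspace [C_n] consists of the vectors supported on the indices with
[q_i >= n - 1] ([adapted_basis]), and the three assertions are read off. *)

(** * Fractions and evaluation of Laurent polynomials *)

Local Notation "p %:F" := (tofrac p).

Section LaurentFractions.
Variable F : fieldType.
Implicit Types (x y : laurent F) (p : {poly F}).

Definition laurent_num_den x (pn : {poly F} * nat) :=
  laurent_val x * ('X^(pn.2))%:F = pn.1%:F.

Lemma laurent_num_denP x : exists p n, laurent_num_den x (p, n).
Proof. by have /asboolP[p [n xE]] := laurent_valP x; exists p, n. Qed.

Lemma laurent_num_denM x y p q n m :
  laurent_num_den x (p, n) -> laurent_num_den y (q, m) ->
  laurent_num_den (x * y) (p * q, (n + m)%N).
Proof.
by rewrite /laurent_num_den /= exprD !tofracM => <- <-; rewrite mulrACA.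
Qed.

Lemma laurent_num_denB x y p q n m :
  laurent_num_den x (p, n) -> laurent_num_den y (q, m) ->
  laurent_num_den (x - y) (p * 'X^m - q * 'X^n, (n + m)%N).
Proof.
rewrite /laurent_num_den /= exprD tofracB !tofracM mulrBl => <- <-.
by rewrite mulrA; congr (_ - _); rewrite -mulrA [_%:F * _]mulrC mulrA.
Qed.

Lemma laurent_num_den_poly p : laurent_num_den (laurent_poly p) (p, 0%N).
Proof. by rewrite /laurent_num_den expr0 mulr1. Qed.

Lemma laurent_num_den_mul x p n : laurent_num_den x (p, n) ->
  x * laurent_t F ^+ n = laurent_poly p.
Proof.
move=> xE; apply: val_inj; rewrite rmorphM rmorphXn /=.
by rewrite -xE /= tofracXn.
Qed.

Lemma laurent_poly_is_zmod_morphism : zmod_morphism (@laurent_poly F).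
Proof. by move=> p q; apply: val_inj; rewrite rmorphB /= tofracB. Qed.

Lemma laurent_poly_is_monoid_morphism : monoid_morphism (@laurent_poly F).
Proof.
by split=> [|p q]; apply: val_inj; rewrite ?rmorph1 ?rmorphM /= ?tofrac1 ?tofracM.
Qed.

HB.instance Definition _ := GRing.isZmodMorphism.Build {poly F} (laurent F)
  (@laurent_poly F) laurent_poly_is_zmod_morphism.
HB.instance Definition _ := GRing.isMonoidMorphism.Build {poly F} (laurent F)
  (@laurent_poly F) laurent_poly_is_monoid_morphism.

Lemma tofracX_neq0 : 'X%:F != 0 :> {fraction {poly F}}.
Proof. by rewrite tofrac_eq0 polyX_eq0. Qed.

Lemma laurent_tpow_subproof (d : int) :
  ('X%:F : {fraction {poly F}}) ^ d \in @laurent_pred F.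
Proof.
apply/asboolP; case: d => n.
  by exists 'X^n, 0%N; rewrite expr0 mulr1 tofracXn.
exists 1, n.+1; rewrite tofracXn NegzE tofrac1 -exprnN mulVf//.
by rewrite expf_neq0// tofracX_neq0.
Qed.

(** The powers of [t] with integer exponents, as Laurent polynomials: [t] is
invertible in this ring, but the ring carries no inverse operation. *)
Definition laurent_tpow (d : int) : laurent F :=
  MkLaurent (laurent_tpow_subproof d).

Lemma laurent_tpow_nat n : laurent_tpow n%:Z = laurent_t F ^+ n.
Proof. by apply: val_inj; rewrite rmorphXn. Qed.

Lemma laurent_tpowD d e :
  laurent_tpow (d + e) = laurent_tpow d * laurent_tpow e.
Proof. by apply: val_inj; rewrite rmorphM /= expfzDr// tofracX_neq0. Qed.

End LaurentFractions.

Section LaurentEvaluation.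
Variables (F : fieldType) (B : unitAlgType F) (b : B).
Implicit Types (x y : laurent F) (p : {poly F}) (n : nat).

(** Evaluation at a unit of an algebra, with the same choice of a fraction as in
[laurent_eval]. It is needed at matrices as well as at scalars; the proof that
[b] is a unit is a parameter so that the morphism structure can be declared. *)
Definition laurent_alg (ub : b \is a GRing.unit) x : B :=
  let pn := xget (0, 0%N) [set pn | laurent_num_den x pn] in
  horner_alg b pn.1 * b ^- pn.2.

Variable ub : b \is a GRing.unit.

Lemma laurent_algE x p n : laurent_num_den x (p, n) ->
  laurent_alg ub x * b ^+ n = horner_alg b p.
Proof.
rewrite /laurent_alg; set pn := xget _ _ => xE.
have : laurent_num_den x pn.
  by apply: xgetPex; have [q [m ?]] := laurent_num_denP x; exists (q, m).
case: pn => q m /= yE.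
have /eqP : (q * 'X^n)%:F = ('X^m * p)%:F :> {fraction {poly F}}.
  by rewrite !tofracM -xE -yE /= mulrAC mulrC.
rewrite tofrac_eq => /eqP/(congr1 (horner_alg b)).
rewrite !rmorphM !rmorphXn /= !horner_algX => E.
have ubm : b ^+ m \is a GRing.unit by rewrite unitrX.
have C i r : horner_alg b r * b ^+ i = b ^+ i * horner_alg b r.
  by rewrite -[X in X ^+ i](horner_algX b) -rmorphXn -!rmorphM mulrC.
apply: (mulrI ubm); rewrite -E !mulrA -C.
by rewrite mulrK.
Qed.

Lemma laurent_alg_poly p : laurent_alg ub (laurent_poly p) = horner_alg b p.
Proof. by rewrite -(laurent_algE (laurent_num_den_poly p)) mulr1. Qed.

Lemma laurent_alg_tpow (d : int) : laurent_alg ub (laurent_tpow F d) = b ^ d.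
Proof.
case: d => n; first by rewrite laurent_tpow_nat -rmorphXn laurent_alg_poly
  rmorphXn /= horner_algX.
have ubn : b ^+ n.+1 \is a GRing.unit by rewrite unitrX.
apply: (mulIr ubn); rewrite (@laurent_algE _ 1); last first.
  rewrite /laurent_num_den /= tofracXn NegzE -exprnN mulVf ?tofrac1//.
  by rewrite expf_neq0// tofracX_neq0.
by rewrite rmorph1 NegzE -exprnN mulVr.
Qed.

Lemma laurent_alg_is_zmod_morphism : zmod_morphism (laurent_alg ub).
Proof.
move=> x y; have [p [n xE]] := laurent_num_denP x.
have [q [m yE]] := laurent_num_denP y.
have ubnm : b ^+ (n + m) \is a GRing.unit by rewrite unitrX.
apply: (mulIr ubnm); rewrite (laurent_algE (laurent_num_denB xE yE)).
rewrite rmorphB !rmorphM !rmorphXn /= !horner_algX mulrBl.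
by rewrite -(laurent_algE xE) -(laurent_algE yE) -!mulrA -!exprD [(m + n)%N]addnC.
Qed.

Lemma laurent_alg_is_monoid_morphism : monoid_morphism (laurent_alg ub).
Proof.
split=> [|x y]; first by rewrite -(rmorph1 (@laurent_poly F)) laurent_alg_poly rmorph1.
have [p [n xE]] := laurent_num_denP x; have [q [m yE]] := laurent_num_denP y.
have ubnm : b ^+ (n + m) \is a GRing.unit by rewrite unitrX.
apply: (mulIr ubnm); rewrite (laurent_algE (laurent_num_denM xE yE)) rmorphM.
rewrite /= exprD.
have C r i : b ^+ i * horner_alg b r = horner_alg b r * b ^+ i.
  by rewrite -[X in X ^+ i](horner_algX b) -rmorphXn -!rmorphM mulrC.
have ubm : b ^+ m \is a GRing.unit by rewrite unitrX.
move: (laurent_algE xE) (laurent_algE yE) (C q n) => <- <-.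
move: (laurent_alg ub x) (laurent_alg ub y) => u v Cv.
rewrite -!mulrA; congr (u * _); rewrite Cv -mulrA; congr (v * _).
by rewrite -!exprD addnC.
Qed.

HB.instance Definition _ := GRing.isZmodMorphism.Build (laurent F) B
  (laurent_alg ub) laurent_alg_is_zmod_morphism.
HB.instance Definition _ := GRing.isMonoidMorphism.Build (laurent F) B
  (laurent_alg ub) laurent_alg_is_monoid_morphism.

End LaurentEvaluation.

Section ScalarEvaluation.
Variables (F : fieldType) (a : F).

Lemma horner_alg_scalar (p : {poly F}) : horner_alg (a : F^o) p = p.[a].
Proof. by rewrite /horner_alg /horner_morph map_poly_id // => c _; exact: mulr1. Qed.

Hypothesis a0 : a != 0.

Lemma scalar_unit : (a : F^o) \is a GRing.unit.
Proof. by rewrite unitfE. Qed.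

Lemma laurent_evalE (x : laurent F) :
  laurent_eval x a = laurent_alg scalar_unit x.
Proof. by rewrite /laurent_alg /= horner_alg_scalar. Qed.

End ScalarEvaluation.

(** * The determinant trick and Jordan blocks *)

Section DeterminantTrick.
Variables (L : comNzRingType) (M : lmodType L).

(** The easy half of the Cauchy-Binet formula, by expanding the determinant
along all choices of a row of [P] for each row of [U]; the coefficients do not
depend on the permutation. *)
Lemma det_mulmx_minors r g (U : 'M[L]_(g, r)) (P : 'M[L]_(r, g)) :
  maximal_minors_ideal P (\det (U *m P)).
Proof.
exists (fun f => \prod_i U i (f i)); rewrite /determinant.
under eq_bigr => s _.
  under eq_bigr do rewrite mxE.
  rewrite bigA_distr_bigA mulr_sumr; over.
rewrite exchange_big; apply: eq_bigr => f _ /=.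
rewrite mulr_sumr; apply: eq_bigr => s _.
rewrite big_split /= mulrCA; congr (_ * (_ * _)).
by apply: eq_bigr => i _; rewrite mxE.
Qed.

(** Writing each generator as [s] times a combination of generators gives a
matrix [N = 1 - s W] whose rows are relations. Hence [N = U P], its determinant
lies in the order ideal, kills [M] by the adjugate formula, and is sent to
[det 1 = 1] by any morphism killing [s]. *)
Lemma order_of_divisible (d s : L) (K : comNzRingType) (ev : {rmorphism L -> K}) :
  is_order M d -> (forall m : M, exists w, m = s *: w) -> ev s = 0 ->
  exists c, ev (c * d) = 1 /\ forall m : M, (c * d) *: m = 0.
Proof.
move=> [r [g [P [x [[gen rel] minors]]]]] div evs.
have /choice[w xE] : forall j, exists w : 'rV[L]_g,
    x j = \sum_(i < g) (s * w 0 i) *: x i.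
  move=> j; have [m ->] := div (x j); have [v ->] := gen m.
  exists v; rewrite scaler_sumr; apply: eq_bigr => i _.
  by rewrite scalerA.
pose W : 'M[L]_g := \matrix_(j, i) w j 0 i.
pose N : 'M[L]_g := 1%:M - s *: W.
have Nx j : \sum_(i < g) N j i *: x i = 0.
  under eq_bigr do rewrite !mxE scalerBl.
  rewrite sumrB -xE (bigD1 j)//= eqxx scale1r big1 ?addr0 ?subrr// => i ij.
  by rewrite eq_sym (negbTE ij) scale0r.
have /choice[u uE] : forall j, exists u, row j N = u *m P.
  move=> j; apply/rel; rewrite -[RHS](Nx j).
  by apply: eq_bigr => i _; rewrite !mxE.
pose U : 'M[L]_(g, r) := \matrix_(j, i) u j 0 i.
have NE : N = U *m P.
  apply/row_matrixP => j; rewrite row_mul uE; congr (_ *m _).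
  by apply/rowP => i; rewrite !mxE.
have := det_mulmx_minors U P; rewrite minors => -[c _ cdE]; exists c.
rewrite cdE -NE; split=> [|m].
  rewrite -det_map_mx map_mxB map_mxZ evs scale0r subr0 map_mx1.
  exact: det1.
have [v ->] := gen m; rewrite scaler_sumr big1// => j _.
rewrite scalerA mulrC -scalerA; suff -> : \det N *: x j = 0 by rewrite scaler0.
have -> : \det N *: x j = \sum_i (\adj N *m N) j i *: x i.
  rewrite mul_adj_mx (bigD1 j)//= mxE eqxx mulr1n big1 ?addr0// => i ij.
  by rewrite mxE eq_sym (negbTE ij) mulr0n scale0r.
under eq_bigr do rewrite mxE scaler_suml.
rewrite exchange_big big1//= => l _.
under eq_bigr do rewrite -scalerA.
by rewrite -scaler_sumr Nx scaler0.
Qed.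

End DeterminantTrick.

Section JordanBlock.
Variables (F : fieldType) (m : nat).
Local Notation N := (nilpotent_shift F m.+1).
Local Notation J := (1 + N).

Lemma mul_row_shift (v : 'rV[F]_m.+1) n j :
  (v *m N ^+ n) 0 j = if (n <= j)%N then v 0 (inord (j - n)) else 0.
Proof.
elim: n j => [|n IHn] j.
  by rewrite expr0 mulmx1 subn0 inord_val.
rewrite exprSr -mulmxE mulmxA mxE.
under eq_bigr do rewrite IHn mxE.
have [nj|jn] := ltnP n j; last first.
  rewrite big1// => i _; case: eqP => [ji|]; last by rewrite mulr0.
  by rewrite leqNgt -ji jn mul0r.
have jm : (j.-1 < m.+1)%N by rewrite (leq_ltn_trans (leq_pred _)).
have jE : j = j.-1.+1 :> nat by rewrite prednK//; apply: leq_ltn_trans nj.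
rewrite (bigD1 (Ordinal jm))//= -jE eqxx mulr1 big1 ?addr0; last first.
  move=> i; rewrite -val_eqE /= => ij; case: eqP => [ji|]; last by rewrite mulr0.
  by rewrite ji eqxx in ij.
have -> : (n <= j.-1)%N by rewrite -ltnS -jE.
by congr (v 0 (inord _)); rewrite [in RHS]jE subSS.
Qed.

Lemma shift_nilp n : (m < n)%N -> N ^+ n = 0.
Proof.
move=> mn; apply/row_matrixP => i; rewrite rowE; apply/rowP => j.
rewrite mul_row_shift !mxE leqNgt.
by rewrite (leq_trans (ltn_ord j) mn).
Qed.

Lemma jordan_unit : J \is a GRing.unit.
Proof.
rewrite unitmxE -det_tr det_trig; last first.
  apply/is_trig_mxP => i j ij; rewrite !mxE.
  by rewrite gt_eqF// ltn_eqF ?addr0//; apply: ltn_trans ij _.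
by rewrite big1 ?unitr1// => i _; rewrite !mxE eqxx ltn_eqF ?addr0.
Qed.

(** [J] is unipotent and upper triangular, so right multiplication by its powers
does not change the first coordinate. *)
Lemma mul_row_jordan_exp (v : 'rV[F]_m.+1) (d : int) :
  (v *m J ^ d) 0 0 = v 0 0.
Proof.
have JX n (w : 'rV[F]_m.+1) : (w *m J ^+ n) 0 0 = w 0 0.
  elim: n w => [|n IHn] w; first by rewrite expr0 mulmx1.
  rewrite exprS -mulmxE mulmxA IHn mulmxDr mulmx1 mxE.
  by have := mul_row_shift w 1 0; rewrite expr1 => ->; rewrite addr0.
case: d => n; first exact: JX.
rewrite -[RHS](JX n.+1) -(JX n.+1 (v *m _)) -mulmxA mulmxE NegzE -exprnN.
have J1 : J ^+ n.+1 \is a GRing.unit by rewrite unitrX// jordan_unit.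
by rewrite mulVr// mulmx1 JX.
Qed.

Variable a : F.
(** The matrix by which [t] acts, on the right, on the values of a row cocycle. *)
Definition jordan_inv : 'M[F]_m.+1 := a *: J^-1.
Local Notation A := jordan_inv.

Lemma jordan_inv_unit : a != 0 -> A \is a GRing.unit.
Proof.
by move=> a0; rewrite /A scaler_unit ?unitfE// unitrV jordan_unit.
Qed.

(** The relation that turns the module action of [t] into the twisted cocycle
relation. *)
Lemma jordan_inv_expz d : a != 0 -> A ^ d *m J ^ d = (a ^ d)%:M.
Proof.
move=> a0; have E : A * J = a%:A by rewrite /A -scalerAl mulVr// jordan_unit.
have C : GRing.comm A J.
  rewrite /GRing.comm E /A -scalerAr; congr (_ *: _).
  exact/esym/mulrV/jordan_unit.
have X n : A ^+ n * J ^+ n = (a ^+ n)%:A.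
  by rewrite -exprMn_comm// E exprZn expr1n.
case: d => n; first by rewrite -[RHS]scalemx1; exact: X.
rewrite !NegzE -!exprnN mulmxE -invrM ?unitrX ?jordan_unit ?jordan_inv_unit//.
have -> : J ^+ n.+1 * A ^+ n.+1 = A ^+ n.+1 * J ^+ n.+1.
  by apply: commrX; apply/commr_sym/commrX.
by rewrite X invrZ ?unitfE ?expf_neq0// ?unitr1// invr1 -scalemx1.
Qed.

Lemma jordan_inv_subX n :
  (A - a%:M) ^+ n = (- a) ^+ n *: (N ^+ n * J^-1 ^+ n).
Proof.
have -> : A - a%:M = (- a) *: (N * J^-1).
  have -> : N * J^-1 = 1 - J^-1.
    by rewrite -{1}[N](addKr 1) addrC mulrBl mul1r divrr// jordan_unit.
  by rewrite scaleNr scalerBr opprB -scalemx1.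
rewrite exprZn exprMn_comm//; apply/commrV.
by apply: commrD; [exact: commr1|exact: commr_refl].
Qed.

Lemma jordan_inv_nilp n : (m < n)%N -> (A - a%:M) ^+ n = 0.
Proof. by move=> mn; rewrite jordan_inv_subX shift_nilp// mul0r scaler0. Qed.

(** The [n]-th coordinate of [v N^n] is the first coordinate of [v]. *)
Lemma jordan_inv_ker n (v : 'rV[F]_m.+1) : a != 0 -> (n <= m)%N ->
  v *m (A - a%:M) ^+ n = 0 -> v 0 0 = 0.
Proof.
move=> a0 nm; rewrite jordan_inv_subX -scalemxAr => /eqP.
rewrite scaler_eq0 expf_eq0 oppr_eq0 (negbTE a0) andbF /= => /eqP.
move=> /(congr1 (fun w => w *m J ^+ n)).
rewrite mul0mx -mulmxA mulmxE -mulrA exprVn mulVr ?unitrX ?jordan_unit// mulr1.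
move=> /rowP/(_ (inord n)); rewrite mul_row_shift mxE inordK// leqnn subnn.
by have -> : inord 0 = 0 :> 'I_m.+1 by apply: val_inj; rewrite /= inordK.
Qed.

(** The first coordinate of rows is an eigenvector, for the eigenvalue [a], of
the action of [jordan_inv] on coordinates. *)
Lemma mul_row_horner_jordan_inv (v : 'rV[F]_m.+1) (p : {poly F}) :
  (v *m horner_alg A p) 0 0 = p.[a] * v 0 0.
Proof.
have AE (w : 'rV[F]_m.+1) : (w *m A) 0 0 = a * w 0 0.
  by rewrite /A -scalemxAr mxE (mul_row_jordan_exp _ (-1)).
elim/poly_ind: p => [|p c IHp]; first by rewrite rmorph0 mulmx0 mxE horner0 mul0r.
rewrite rmorphD rmorphM /= horner_algX horner_algC hornerMXaddC mulmxDr mulmxA.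
by rewrite mxE AE IHp -scalemxAr mulmx1 mxE mulrDl mulrA [a * _]mulrC.
Qed.

End JordanBlock.

(** * Integer powers and abelianizations *)

Section IntegerPowers.
Local Open Scope group_scope.
Variable G : groupType.

Definition expgz (g : G) (d : int) : G :=
  match d with Posz n => g ^+ n | Negz n => g ^- n.+1 end.

Lemma expgz_subn g (m n : nat) : expgz g (m%:Z - n%:Z)%R = g ^+ m * g ^- n.
Proof.
have [mn|/ltnW nm] := leqP n m.
  by rewrite subzn//= expgnFr.
rewrite -opprB subzn//.
have -> : expgz g (- (n - m)%N%:Z)%R = g ^- (n - m).
  by case: (n - m)%N => [|k]; rewrite ?oppr0 /= ?expg0 ?invg1// -NegzE.
rewrite expgnFr// invgM invgK.
by [].
Qed.

Lemma expgzD g d e : expgz g (d + e)%R = expgz g d * expgz g e.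
Proof.
have [m [n ->]] : exists m n : nat, d = (m%:Z - n%:Z)%R.
  by case: d => n; [exists n, 0%N; rewrite subr0 | exists 0%N, n.+1; rewrite NegzE sub0r].
have [m' [n' ->]] : exists m n : nat, e = (m%:Z - n%:Z)%R.
  by case: e => k; [exists k, 0%N; rewrite subr0 | exists 0%N, k.+1; rewrite NegzE sub0r].
rewrite addrACA -opprD -!PoszD !expgz_subn expgnDr [(n + n')%N]addnC expgnDr invgM.
rewrite !mulgA; congr (_ * _); rewrite -!mulgA; congr (_ * _).
apply: commuteV; apply: commute_sym; apply: commuteX.
by apply: commute_sym; apply: commuteX.
Qed.

Lemma expgzN g d : expgz g (- d)%R = (expgz g d)^-1.
Proof.
apply: (mulgI (expgz g d)); rewrite -expgzD subrr mulgV.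
by rewrite /= expg0.
Qed.

End IntegerPowers.

Section AdditiveMaps.
Variables (G : groupType) (N : zmodType) (f : G -> N).
Hypothesis fM : {morph f : x y / (x * y)%g >-> x + y}.

Lemma morph_derived x : x \in derived_pred G -> f x = 0.
Proof.
have f1 : f 1%g = 0 by apply: (addrI (f 1%g)); rewrite -fM mulg1 addr0.
have fV y : f y^-1%g = - f y.
  by apply: (addrI (f y)); rewrite -fM mulgV f1 subrr.
move=> /derived_predP/(_ [pred x | f x == 0]) /= H; apply/eqP; apply: H.
  split=> [|y z]; rewrite ?inE ?f1// => /eqP fy /eqP fz.
  by rewrite ?fM ?fV ?fy ?fz ?oppr0 addr0.
move=> a b; rewrite inE /commg /conjg !fM !fV.
by rewrite [- f b + _]addrC addrK addNr.
Qed.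

(** Well defined because an additive map to an abelian group kills commutators. *)
Lemma ab_lift : exists f' : abelianization G -> N,
  {morph f' : u v / u + v} /\ forall x, f' (to_ab x) = f x.
Proof.
exists (f \o repr).
have E x : f (repr (to_ab x)) = f x.
  have /to_abP := repr_to_ab x; move: (repr _) => y yx.
  by rewrite -[x](mulVKg y) fM (morph_derived yx) addr0.
split=> // u v; rewrite -fM.
exact: (E (repr u * repr v)%g).
Qed.

End AdditiveMaps.

(** * The Alexander module as a target of a crossed homomorphism *)

Section AlexanderModule.
Variables (G : groupType) (F : fieldType) (mu : G) (deg : G -> int).
Hypothesis hdeg : is_degree mu deg.
Variables (M : lmodType (laurent F)).
Variable tens : abelianization (derived_group G) -> F -> M.
Hypothesis hM : is_alexander_module mu tens.
Local Notation t := (laurent_t F).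
Implicit Types (x y : G) (u v : derived_group G) (z : F) (m w : M).

Lemma degM : {morph deg : x y / (x * y)%g >-> x + y}.
Proof. by case: hdeg. Qed.

Lemma deg1 : deg 1%g = 0.
Proof. by apply: (addrI (deg 1%g)); rewrite -degM mulg1 addr0. Qed.

Lemma degV x : deg x^-1%g = - deg x.
Proof. by apply: (addrI (deg x)); rewrite -degM mulgV deg1 subrr. Qed.

Lemma deg_derived u : deg u = 0.
Proof. by case: hdeg => _ -> _; exact: derived_valP. Qed.

Lemma deg_expgz d : deg (expgz mu d) = d.
Proof.
have degX n : deg (mu ^+ n)%g = n.
  elim: n => [|n IHn]; first exact: deg1.
  by rewrite expgS degM IHn; case: hdeg => _ _ ->; rewrite intS.
by case: d => n; rewrite /= ?degV degX ?NegzE.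
Qed.

Lemma tens_ext (N : zmodType) (h1 h2 : M -> N) :
  {morph h1 : m w / m + w} -> {morph h2 : m w / m + w} ->
  (forall b z, h1 (tens b z) = h2 (tens b z)) -> h1 =1 h2.
Proof.
case: hM => -[[tDl tDr] univ] _ _ h1D h2D h12 m.
have [|h [_ hu]] := univ N (fun b z => h1 (tens b z)).
  by split=> [b b' z|b z z']; rewrite ?tDl ?tDr h1D.
have <- : h = h1 by apply: hu.
have <- // : h = h2 by apply: hu; split=> // b z; rewrite h12.
Qed.

(** The quotient by [H] receives two additive maps that agree on tensors, the
projection and zero. *)
Lemma tens_generate (H : {pred M}) : zmod_closed H ->
  (forall b z, tens b z \in H) -> forall m, m \in H.
Proof.
move=> Hc Ht m.
pose I : zmodClosed M := HB.pack H (GRing.isZmodClosed.Build M H Hc).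
pose p w : Quotient.quot I := \pi_(Quotient.quot I)%qT w.
have : p m = 0.
  apply: (@tens_ext _ p (fun=> 0)) => [w w'|w w'|b z].
  - by rewrite /p raddfD.
  - by rewrite addr0.
  - rewrite -[RHS](raddf0 (\pi_(Quotient.quot I)%qT)); apply/eqP.
    by rewrite -Quotient.idealrBE subr0; exact: Ht.
rewrite -[RHS](raddf0 (\pi_(Quotient.quot I)%qT)) => /eqP.
by rewrite -Quotient.idealrBE subr0.
Qed.

Lemma tensDl b b' z : tens (b + b') z = tens b z + tens b' z.
Proof. by have [[[tDl _] _] _ _] := hM; exact: tDl. Qed.

Lemma tens_conj d u z :
  tens (to_ab (conj_derived (expgz mu d) u)) z =
  laurent_tpow F d *: tens (to_ab u) z.
Proof.
have tX n v : tens (to_ab (conj_derived (mu ^+ n)%g v)) z =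
              t ^+ n *: tens (to_ab v) z.
  elim: n => [|n IHn].
    rewrite scale1r; congr (tens (to_ab _) z); apply: val_inj => /=.
    by rewrite invg1 mulg1 mul1g.
  rewrite exprS -scalerA -IHn; have [_ -> _] := hM; congr (tens (to_ab _) z).
  by apply: val_inj; rewrite /= expgS invgM !mulgA.
case: d => n; first by rewrite laurent_tpow_nat -tX.
set v := conj_derived _ _.
have -> : tens (to_ab u) z = t ^+ n.+1 *: tens (to_ab v) z.
  rewrite -tX; congr (tens (to_ab _) z); apply: val_inj => /=.
  by rewrite invgK !mulgA mulgV mul1g -mulgA mulgV mulg1.
rewrite -laurent_tpow_nat scalerA -laurent_tpowD NegzE addNr.
by rewrite laurent_tpow_nat scale1r.
Qed.

Lemma untwist_subproof x : (x * expgz mu (- deg x))%g \in derived_pred G.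
Proof. by case: hdeg => _ <- _; rewrite degM deg_expgz subrr. Qed.

(** The component of [x] in the derived group for the decomposition
[G = G' mu^Z]. *)
Definition untwist x : derived_group G := DerivedGroup (untwist_subproof x).

(** For fixed [z] this is a crossed homomorphism, by [magnusM]; it is the one
that underlies the Magnus embedding of the metabelian quotient of [G]. Row
cocycles are obtained by composing it with module maps. *)
Definition magnus x z : M := tens (to_ab (untwist x)) z.

Lemma magnus_derived u z : magnus u z = tens (to_ab u) z.
Proof.
rewrite /magnus; congr (tens (to_ab _) z); apply: val_inj.
by rewrite /= deg_derived oppr0 mulg1.
Qed.

Lemma magnusM x y z :
  magnus (x * y)%g z = magnus x z + laurent_tpow F (deg x) *: magnus y z.
Proof.
rewrite /magnus -tens_conj -tensDl; congr (tens _ z).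
rewrite -[RHS]/(ab_add _ _) ab_addE; congr to_ab; apply: val_inj => /=.
rewrite degM opprD [(- deg x + _)%R]addrC expgzD -[in RHS]expgzN.
by rewrite !mulgA; congr (_ * _ * _ * _)%g; rewrite -mulgA -expgzD addNr mulg1.
Qed.

Lemma scale_tpow_sub d m :
  exists w, laurent_tpow F d *: m - m = (t - laurent_const 1) *: w.
Proof.
have tX n m' : exists w, t ^+ n *: m' - m' = (t - laurent_const 1) *: w.
  elim: n => [|n [w IHn]].
    by exists 0; rewrite scale1r subrr scaler0.
  exists (t ^+ n *: m' + w).
  rewrite scalerDr -IHn [laurent_const _](rmorph1 (@laurent_poly F)).
  by rewrite scalerBl scalerA -exprS scale1r addrA subrK.
case: d => n; first by rewrite laurent_tpow_nat.
have [w wE] := tX n.+1 (laurent_tpow F (Negz n) *: m).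
exists (- w); rewrite scalerN -wE opprB -laurent_tpow_nat scalerA.
by rewrite -laurent_tpowD NegzE subrr laurent_tpow_nat scale1r.
Qed.

(** Modulo [(t - 1) M] the map [magnus] is a homomorphism to an abelian group,
so it kills the derived group; but on the derived group it takes the tensors as
its values, and these generate [M]. *)
Lemma alexander_divisible m : exists w, m = (t - laurent_const 1) *: w.
Proof.
pose s := t - laurent_const 1.
pose H : {pred M} := [pred m | `[< exists w, m = s *: w >]].
have HP m' : reflect (exists w, m' = s *: w) (m' \in H) by exact: asboolP.
have Hc : zmod_closed H.
  split=> [|m1 m2 /HP[w1 ->] /HP[w2 ->]]; apply/HP.
    by exists 0; rewrite scaler0.
  by exists (w1 - w2); rewrite scalerBr.
have HB m1 m2 : m1 \in H -> m2 \in H -> m1 - m2 \in H by apply: Hc.2.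
have HD m1 m2 : m1 \in H -> m2 \in H -> m1 + m2 \in H.
  move=> h1 h2; rewrite -[m2]opprK HB// -[- m2]sub0r HB//; exact: Hc.1.
have HZ (l : laurent F) m1 : m1 \in H -> l *: m1 \in H.
  by move=> /HP[w ->]; apply/HP; exists (l *: w); rewrite !scalerA mulrC.
have Htp d m1 : laurent_tpow F d *: m1 - m1 \in H by apply/HP; exact: scale_tpow_sub.
have Hcomm z x y : magnus [~ x, y]%g z \in H.
  have E : magnus (x * y)%g z = magnus (y * x * [~ x, y])%g z.
    by congr (magnus _ z); rewrite /commg /conjg !mulgA mulgK mulgV mul1g.
  move: [~ x, y]%g E => c; rewrite !magnusM [RHS]addrC => /eqP.
  rewrite -subr_eq => /eqP E.
  move: (deg (y * x)%g) (magnus c z) E => d {}c E.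
  have -> : c = laurent_tpow F (- d) *: (laurent_tpow F d *: c).
    by rewrite scalerA -laurent_tpowD addNr laurent_tpow_nat scale1r.
  apply: HZ.
  rewrite -E [magnus x z + _]addrC opprD addrACA -[X in _ + X]opprB.
  by apply: HB.
suff : m \in H by move/HP.
apply: tens_generate => // b z; rewrite -[b]to_ab_repr -magnus_derived.
move: (repr b) => u; have /derived_predP := derived_valP u.
move=> /(_ [pred x | magnus x z \in H]) /=; apply.
  split=> [|x y]; rewrite ?inE.
    have /eqP := magnusM 1%g 1%g z; rewrite mulg1 deg1 laurent_tpow_nat scale1r.
    by rewrite -subr_eq subrr => /eqP <-; exists 0; rewrite scaler0.
  move=> /HP hx /HP hy; apply/HP; have := magnusM (x / y)%g y z; rewrite mulgVK.
  by move=> /eqP; rewrite -subr_eq => /eqP <-; apply: HB => //; exact: HZ.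
by move=> x y; exact: Hcomm.
Qed.

End AlexanderModule.

(** * Row cocycles and module maps *)

Section RowCocycles.
Variables (G : groupType) (F : fieldType) (mu : G) (deg : G -> int).
Hypothesis hdeg : is_degree mu deg.
Variables (M : lmodType (laurent F)).
Variable tens : abelianization (derived_group G) -> F -> M.
Hypothesis hM : is_alexander_module mu tens.
Variable a : F.
Hypothesis a0 : a != 0.
Local Notation t := (laurent_t F).
Implicit Types (x y : G) (u v : derived_group G) (z : F) (m w : M).

(** [h] is the additive map on the Alexander module induced by the restriction
of [f] to the derived group. *)
Definition alexander_extends (N : lmodType F) (f : G -> N) (h : M -> N) :=
  {morph h : m w / m + w} /\ forall u z, h (tens (to_ab u) z) = z *: f u.

Lemma alexander_extends_exists (N : lmodType F) (f : G -> N) :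
  (forall u v, f (u * v)%g = f u + f v) -> exists h, alexander_extends f h.
Proof.
move=> fM; have [f' [f'D f'E]] := @ab_lift _ _ (f \o @derived_val G) fM.
have [[_ univ] _ _] := hM; have [|h [[hD hE] _]] := univ N (fun b z => z *: f' b).
  by split=> [b b' z|b z z']; rewrite ?f'D ?scalerDr ?scalerDl.
by exists h; split=> // u z; rewrite hE f'E.
Qed.

Lemma alexander_extends_unique (N : lmodType F) (f1 f2 : G -> N) h1 h2 :
  alexander_extends f1 h1 -> alexander_extends f2 h2 ->
  (forall u, f1 u = f2 u) -> h1 =1 h2.
Proof.
move=> [h1D h1E] [h2D h2E] f12; apply: (tens_ext hM) => // b z.
by rewrite -(to_ab_repr b) h1E h2E f12.
Qed.

(** Additive maps coming from the derived group are linear over the constants,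
because the scalars of [M] act on the second factor of the tensor product. *)
Lemma alexander_extends_const (N : lmodType F) (f : G -> N) h c m :
  alexander_extends f h -> h (laurent_const c *: m) = c *: h m.
Proof.
move=> [hD hE].
apply: (tens_ext hM (h1 := fun m => h (laurent_const c *: m))
  (h2 := fun m => c *: h m)) => [w w'|w w'|b z].
- by rewrite scalerDr hD.
- by rewrite hD scalerDr.
- by have [_ _ ->] := hM; rewrite -(to_ab_repr b) !hE scalerA.
Qed.

Section Rows.
Variable n : nat.
Local Notation J := (1 + nilpotent_shift F n.+1).
Local Notation A := (jordan_inv n a).
Local Notation ev := (laurent_alg (jordan_inv_unit n a0)).

(** The condition on the upper right block under which the block matrices
[rho] multiply correctly. *)
Definition row_cocycle (V : G -> 'rV[F]_n.+1) :=
  forall x y, V (x * y)%g = a ^ deg x *: V y + V x *m J ^ deg y.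

(** For [u] in the derived group and [w = mu u mu^-1], computing [V (mu u)] and
[V (w mu)] gives [V(w) J = a V(u)]. Thus [t] acts as [jordan_inv], and the
action of the other Laurent polynomials follows by multiplicativity. *)
Lemma row_cocycle_extends V : row_cocycle V ->
  exists h, alexander_extends V h /\ forall l m, h (l *: m) = h m *m ev l.
Proof.
move=> VM.
have VD u v : V (u * v)%g = V u + V v.
  by rewrite VM !(deg_derived hdeg) scale1r mulmx1 addrC.
have [h [hD hE]] := alexander_extends_exists VD; exists h; split=> //.
have ht m : h (t *: m) = h m *m A.
  apply: (tens_ext hM (h1 := fun m => h (t *: m)) (h2 := fun m => h m *m A)).
  - by move=> w w'; rewrite scalerDr hD.
  - by move=> w w'; rewrite hD mulmxDl.
  move=> b z; rewrite -(to_ab_repr b); move: (repr b) => u.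
  have [_ -> _] := hM; rewrite !hE -scalemxAl; congr (z *: _).
  have : V (mu * derived_val u)%g = V (derived_val (conj_derived mu u) * mu)%g.
    by rewrite /= mulgVK.
  move: (conj_derived mu u) => u'; rewrite !VM !(deg_derived hdeg) [in RHS]expr0z scale1r.
  have -> : deg mu = 1 by case: hdeg.
  rewrite expr0z mulmx1 !expr1z addrC => /addrI/(congr1 (mulmx^~ J^-1)) /=.
  rewrite -[RHS]mulmxA [J *m _]mulrV ?jordan_unit// mulmx1 => <-.
  by rewrite /A -scalemxAl scalemxAr.
have htX m i : h (t ^+ i *: m) = h m *m A ^+ i.
  elim: i => [|i IHi]; first by rewrite scale1r mulmx1.
  by rewrite exprS -scalerA ht IHi exprSr mulmxA.
have hp m p : h (laurent_poly p *: m) = h m *m horner_alg A p.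
  elim/poly_ind: p => [|p c IHp].
    rewrite !rmorph0 scale0r mulmx0.
    by apply: (addrI (h 0)); rewrite -hD !addr0.
  rewrite !rmorphD !rmorphM /= scalerDl hD -[laurent_poly 'X]/t.
  rewrite -[laurent_poly c%:P]/(laurent_const c).
  rewrite (alexander_extends_const c m (conj hD hE)) mulrC -scalerA ht IHp.
  by rewrite horner_algX horner_algC mulmxDr mulmxA -[X in _ = _ + X]scalemxAr mulmx1.
move=> l m; have [p [i lE]] := laurent_num_denP l.
have uA : A ^+ i \is a GRing.unit by rewrite unitrX// jordan_inv_unit.
have : h (t ^+ i *: (l *: m)) = h m *m ev l *m A ^+ i.
  rewrite scalerA mulrC (laurent_num_den_mul lE) hp -mulmxA.
  by congr (_ *m _); rewrite -(laurent_algE (jordan_inv_unit n a0) lE).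
rewrite htX => /(congr1 (mulmx^~ (A ^+ i)^-1)) /=.
by rewrite -!mulmxA ![_ *m (A ^+ i)^-1]mulrV// !mulmx1.
Qed.

(** The cocycle is normalized by [V(mu) = 0], which forces
[V (u mu^d) = h(u) J^d]. *)
Lemma row_cocycle_of_extension (h : M -> 'rV[F]_n.+1) :
  {morph h : m w / m + w} -> (forall l m, h (l *: m) = h m *m ev l) ->
  exists V, row_cocycle V /\ alexander_extends V h.
Proof.
move=> hD hZ; exists (fun x => h (magnus hdeg tens x 1) *m J ^ deg x).
split=> [x y|].
  rewrite magnusM// hD hZ laurent_alg_tpow (degM hdeg) exprzDr ?jordan_unit//.
  rewrite -mulmxE mulmxDl !mulmxA addrC; congr (_ + _).
  by rewrite -[_ *m A ^ _ *m _]mulmxA jordan_inv_expz// mul_mx_scalar scalemxAl.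
split=> // u z; rewrite magnus_derived (deg_derived hdeg) expr0z mulmx1.
have {1}-> : z = z * 1 by rewrite mulr1.
have [_ _ <-] := hM; rewrite hZ laurent_alg_poly horner_algC.
by rewrite -scalemxAr mulmx1.
Qed.

Lemma row_cocycle_head V : row_cocycle V ->
  forall x y, V (x * y)%g 0 0 = V x 0 0 + a ^ deg x * V y 0 0.
Proof.
by move=> VM x y; rewrite VM 2!mxE mul_row_jordan_exp addrC.
Qed.

End Rows.

End RowCocycles.

(** * Cocycles and the order ideal *)

Section CocyclesAndOrder.
Variables (G : groupType) (F : fieldType) (mu : G) (deg : G -> int).
Hypothesis hdeg : is_degree mu deg.
Variables (M : lmodType (laurent F)).
Variable tens : abelianization (derived_group G) -> F -> M.
Hypothesis hM : is_alexander_module mu tens.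
Variable a : F.
Hypothesis a0 : a != 0.
Local Notation t := (laurent_t F).
Implicit Types (x y : G) (u v : derived_group G) (z : F) (m w : M).

Lemma rho_morph_row_cocycle n (V : 'I_n.+1 -> G -> F) :
  {morph rho deg a V : x y / (x * y)%g >-> x *m y} <->
  row_cocycle deg a (fun x => \row_j V j x).
Proof.
have rhoE x y : rho deg a V x *m rho deg a V y =
    block_mx (a ^ deg (x * y)%g)%:M
      (a ^ deg x *: (\row_j V j y) + (\row_j V j x) *m phi F deg n y)
      0 (phi F deg n (x * y)%g).
  rewrite /rho mulmx_block !mulmx0 !mul0mx !addr0 add0r (degM hdeg).
  rewrite -scalar_mxM expfzDr// mul_scalar_mx; congr block_mx.
  by rewrite /phi (degM hdeg) exprzDr ?jordan_unit.
split=> VM x y; last by rewrite rhoE /rho VM.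
by move: (VM x y); rewrite rhoE => /eq_block_mx[].
Qed.

(** A scalar cocycle is a row cocycle of length one, since [J] is then the
identity. *)
Lemma cocycle_functional (U : cocycle deg a) : exists h : M -> F^o,
  [/\ alexander_extends tens (U : G -> F^o) h,
      forall p m, h (laurent_poly p *: m) = p.[a] * h m &
      forall l m, h m = 0 -> h (l *: m) = 0].
Proof.
have /asboolP UM := cocycle_valP U.
pose V x : 'rV[F]_1 := const_mx (U x).
have [h [[hD hE] hZ]] : exists h, alexander_extends tens V h /\
    forall l m, h (l *: m) = h m *m laurent_alg (jordan_inv_unit 0 a0) l.
  apply: (row_cocycle_extends hdeg hM a0) => x y; apply/rowP => i; rewrite ord1 2!mxE.
  by rewrite mul_row_jordan_exp !mxE UM addrC.
exists (fun m => h m 0 0); split.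
- by split=> [m w|u z]; rewrite ?hD ?hE !mxE.
- by move=> p m; rewrite hZ laurent_alg_poly mul_row_horner_jordan_inv.
- move=> l m hm; have -> : h (l *: m) = 0; last by rewrite mxE.
  have -> : h (l *: m) = h m *m laurent_alg (jordan_inv_unit 0 a0) l by exact: hZ.
  by have -> : h m = 0; [apply/rowP => i; rewrite ord1 hm mxE|rewrite mul0mx].
Qed.

(** Subtracting the coboundary with the same value at [mu], which exists because
[a - 1] is invertible, leaves a cocycle vanishing on [mu] and on the derived
group, hence everywhere. *)
Lemma cocycle_vanish_coboundary (U : cocycle deg a) : a != 1 ->
  (forall u, U u = 0) -> U \in @coboundary_pred _ _ deg a.
Proof.
move=> a1 U0; have /asboolP UM := cocycle_valP U.
have a1' : a - 1 != 0 by rewrite subr_eq0.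
apply/asboolP; exists (U mu / (a - 1)) => x.
pose W y : F := U y - (a ^ deg y - 1) * (U mu / (a - 1)).
have WM y y' : W (y * y')%g = W y + a ^ deg y * W y'.
  rewrite /W UM (degM hdeg) expfzDr//; ring.
have W1 : W 1%g = 0 by have /eqP := WM 1%g 1%g;
  rewrite mulg1 (deg1 hdeg) expr0z mul1r -subr_eq subrr => /eqP <-.
have Wmu : W mu = 0.
  rewrite /W; have -> : deg mu = 1 by case: hdeg.
  by rewrite expr1z mulrCA divff// mulr1 subrr.
have WX n : W (mu ^+ n)%g = 0.
  elim: n => [|n IHn]; first exact: W1.
  by rewrite expgS WM IHn Wmu mulr0 addr0.
have Wz d : W (expgz mu d) = 0.
  case: d => n; first exact: WX.
  have := WM (mu ^- n.+1)%g (mu ^+ n.+1)%g.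
  by rewrite mulVg W1 WX mulr0 addr0.
have Wu u : W u = 0 by rewrite /W U0 (deg_derived hdeg) expr0z subrr mul0r subr0.
apply/eqP; rewrite -subr_eq0; apply/eqP; rewrite -/(W x).
have -> : x = (derived_val (untwist hdeg x) * expgz mu (deg x))%g.
  by rewrite /= -mulgA -expgzD addNr mulg1.
by rewrite WM Wu Wz mulr0 addr0.
Qed.

Section OrderIdeal.
Variable Delta : laurent F.
Hypothesis hDelta : is_order M Delta.

Lemma order_eval_of_divisible c (c0 : c != 0) :
  (forall m, exists w, m = (t - laurent_const c) *: w) ->
  exists l, laurent_alg (scalar_unit c0) (l * Delta) = 1 /\
            forall m, (l * Delta) *: m = 0.
Proof.
move=> div.
have evs : laurent_alg (scalar_unit c0) (t - laurent_const c) = 0.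
  rewrite /laurent_t /laurent_const -rmorphB laurent_alg_poly horner_alg_scalar.
  by rewrite hornerXsubC subrr.
have [l [El kill]] :=
  order_of_divisible (ev := laurent_alg (scalar_unit c0)) hDelta div evs.
by exists l.
Qed.

(** [M] is divisible by [t - 1], so [Delta] does not vanish at [1]. *)
Lemma order_root_neq1 : laurent_eval Delta a = 0 -> a != 1.
Proof.
have [l [El _]] := order_eval_of_divisible (oner_neq0 F) (alexander_divisible hdeg hM).
move=> Da; apply/eqP => a1; move: El Da; rewrite a1 laurent_evalE ?oner_neq0// => c1.
rewrite rmorphM /= => + D0; rewrite (bool_irrelevance (oner_neq0 F) c1) D0 mulr0.
by move/eqP; rewrite eq_sym (oner_eq0 F).
Qed.

Lemma order_root_not_divisible : laurent_eval Delta a = 0 ->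
  ~ forall m, exists w, m = (t - laurent_const a) *: w.
Proof.
rewrite (laurent_evalE a0) => D0 /(order_eval_of_divisible a0)[l [+ _]].
by rewrite rmorphM /= D0 mulr0 => /eqP; rewrite eq_sym (oner_eq0 F).
Qed.

(** [M] is killed by a Laurent polynomial with value [1] at [1], hence by a
nonzero polynomial; [g] is its part prime to [t - a]. Multiplication by [g] is
a substitute for the projection onto the primary part, to which it is equal up
to a unit. *)
Lemma primary_projection : exists g : {poly F}, g.[a] != 0 /\
  forall m, primary_part M (t - laurent_const a) (laurent_poly g *: m).
Proof.
have [l [El kill]] :=
  order_eval_of_divisible (oner_neq0 F) (alexander_divisible hdeg hM).
have [p [n pE]] := laurent_num_denP (l * Delta).
have p0 : p != 0.
  apply/eqP => p0; have := laurent_algE (scalar_unit (oner_neq0 F)) pE.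
  rewrite El p0 rmorph0 mul1r expr1n => /eqP.
  by rewrite (oner_eq0 F).
have [i [g ga gE]] := multiplicity_XsubC p a; exists g.
split; first by move: ga; rewrite p0.
move=> m; exists i; rewrite scalerA /laurent_t /laurent_const -rmorphB -rmorphXn.
rewrite -rmorphM mulrC -gE /= -(laurent_num_den_mul pE) mulrC -scalerA kill.
by rewrite scaler0.
Qed.

End OrderIdeal.

End CocyclesAndOrder.

(** * The filtration in coordinates *)

Lemma divisible_of_unit_add (L : comNzRingType) (M : lmodType L)
    (s c d p : L) (m : M) :
  d * c = 1 -> (c + s * p) *: m = 0 -> exists w, m = s *: w.
Proof.
rewrite scalerDl => dc /eqP; rewrite addr_eq0 => /eqP cm.
exists (- ((d * p) *: m)); rewrite scalerN scalerA mulrCA -[_ *: m]scalerA -scalerN.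
by rewrite -cm scalerA dc scale1r.
Qed.

Section AdaptedBasis.
Variables (G : groupType) (F : fieldType) (mu : G) (deg : G -> int).
Hypothesis hdeg : is_degree mu deg.
Variables (M : lmodType (laurent F)).
Variable tens : abelianization (derived_group G) -> F -> M.
Hypothesis hM : is_alexander_module mu tens.
Variable a : F.
Hypothesis a0 : a != 0.
Local Notation t := (laurent_t F).
Implicit Types (x y : G) (u v : derived_group G) (z : F) (m w : M).

Variable Delta : laurent F.
Hypothesis hDelta : is_order M Delta.
Hypothesis hroot : laurent_eval Delta a = 0.
Variables (k : nat) (q : k.-tuple nat).
Local Notation s := (t - laurent_const a).
Hypothesis hq : is_sum_of_cyclic (primary_part M s) s q.

(** If the primary part were zero, [g] would kill [M]; as [g] is congruent to
the unit [g(a)] modulo [t - a], the module would be divisible by [t - a]. *)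
Lemma cyclic_summands_exist : (0 < k)%N.
Proof.
rewrite lt0n; apply/negP => /eqP k0.
have [g [ga gM]] := primary_projection hdeg hM a hDelta.
apply: (order_root_not_divisible a0 hDelta hroot) => m.
have [e [SE _]] := hq; have := gM m; rewrite SE => -[v].
rewrite big1; last by move=> i _; have := ltn_ord i; rewrite [X in (_ < X)%N]k0.
have [p pE] : exists p, g = g.[a]%:P + ('X - a%:P) * p.
  have : root (g - g.[a]%:P) a by rewrite /root !hornerE subrr.
  by move=> /factor_theorem[p pE]; exists p; rewrite mulrC -pE addrC subrK.
move=> gm0; apply: (@divisible_of_unit_add _ _ _ (laurent_const g.[a])
  (laurent_const g.[a]^-1) (laurent_poly p)).
  by rewrite -rmorphM -polyCM mulVf// rmorph1.
by rewrite -[RHS]gm0 [in RHS]pE rmorphD rmorphM rmorphB.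
Qed.

Lemma laurent_alg_sub_const n :
  laurent_alg (jordan_inv_unit n a0) s = jordan_inv n a - a%:M.
Proof.
rewrite rmorphB /= laurent_alg_poly laurent_alg_poly horner_algX horner_algC.
by rewrite -[X in _ - X]/(a *: 1%:M) scalemx1.
Qed.

(** The map [h] sends [e_i] to a row starting with [c_i]. It is defined by
multiplying by [g] to reach the primary part, expanding along the [e_i], and
letting the coefficients act through [jordan_inv] on the first basis row. The
coefficient of [e_i] is defined modulo [s^q_i], which acts as zero whenever
[c_i] is not zero, because the block has size [n + 1 <= q_i]. *)
Lemma row_cocycle_realize (c : 'I_k -> F) n (e : 'I_k -> M) :
  primary_part M s =
    [set m | exists v : 'I_k -> laurent F, m = \sum_(i < k) v i *: e i] ->
  (forall v : 'I_k -> laurent F, \sum_(i < k) v i *: e i = 0 <->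
       forall i, principal_ideal (s ^+ tnth q i) (v i)) ->
  (forall i, c i != 0 -> (n < tnth q i)%N) ->
  exists V : G -> 'rV[F]_n.+1, exists h,
    [/\ row_cocycle deg a V, alexander_extends tens V h &
        forall i, h (e i) 0 0 = c i].
Proof.
move=> SE ker cq.
have [g [ga gM]] := primary_projection hdeg hM a hDelta.
have /choice[p pE] : forall m, exists v : 'I_k -> laurent F,
    laurent_poly g *: m = \sum_(i < k) v i *: e i.
  by move=> m; have := gM m; rewrite SE => -[v]; exists v.
pose ev := laurent_alg (jordan_inv_unit n a0).
have evs i : c i != 0 -> ev s ^+ tnth q i = 0.
  move=> /cq nq; rewrite /ev laurent_alg_sub_const.
  exact: jordan_inv_nilp.
(* The coefficients of a relation between the [e i] act by zero. *)
have welldef (v : 'I_k -> laurent F) i :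
    \sum_(i < k) v i *: e i = 0 -> c i != 0 -> ev (v i) = 0.
  move=> /ker/(_ i)[r _ <-] /evs evi.
  by rewrite /ev rmorphM rmorphXn /= -/ev evi mulr0.
pose d0 : 'rV[F]_n.+1 := delta_mx 0 0.
pose h m : 'rV[F]_n.+1 := \sum_i (c i / g.[a]) *: (d0 *m ev (p m i)).
have hE m (v : 'I_k -> laurent F) : laurent_poly g *: m = \sum_(i < k) v i *: e i ->
    h m = \sum_i (c i / g.[a]) *: (d0 *m ev (v i)).
  move=> mE; apply: eq_bigr => i _.
  have [->|ci] := eqVneq (c i) 0; first by rewrite mul0r !scale0r.
  congr (_ *: (_ *m _)); apply/eqP; rewrite -subr_eq0 -rmorphB; apply/eqP.
  apply: (welldef (fun i => p m i - v i)) => //.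
  under eq_bigr do rewrite scalerBl.
  by rewrite sumrB -pE -mE subrr.
have hD : {morph h : m w / m + w}.
  move=> m w; rewrite (hE _ (fun i => p m i + p w i)).
    rewrite -big_split; apply: eq_bigr => i _ /=.
    by rewrite /ev rmorphD mulmxDr scalerDr.
  by rewrite scalerDr !pE -big_split; apply: eq_bigr => i _; rewrite scalerDl.
have hZ l m : h (l *: m) = h m *m ev l.
  rewrite (hE _ (fun i => p m i * l)).
    rewrite mulmx_suml; apply: eq_bigr => i _ /=.
    by rewrite /ev rmorphM /= -scalemxAl mulmxA.
  rewrite scalerA mulrC -scalerA pE scaler_sumr; apply: eq_bigr => i _.
  by rewrite scalerA mulrC.
have [V [VM Vh]] := row_cocycle_of_extension hdeg hM (a0 := a0) hD hZ.
exists V, h; split=> // i.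
(* For [e i] the expansion of [g *: e i] has the single coefficient [g], whose
   action on the first coordinate is multiplication by [g.[a]]; the
   denominators in [h] cancel it. *)
rewrite (hE (e i) (fun j => (i == j)%:R * laurent_poly g)); last first.
  rewrite (bigD1 i)//= eqxx mul1r big1 ?addr0// => j ij.
  by rewrite eq_sym (negbTE ij) mul0r scale0r.
rewrite (bigD1 i)//= eqxx mul1r big1 ?addr0; last first.
  by move=> j ij; rewrite eq_sym (negbTE ij) mul0r /ev raddf0 mulmx0 scaler0.
rewrite mxE /ev laurent_alg_poly mul_row_horner_jordan_inv mxE !eqxx mulr1.
by rewrite divfK.
Qed.


Lemma cohomology_class_sum (I : finType) (c : I -> F) (W : I -> cocycle deg a) :
  \sum_i c i *: cohomology_class (W i) = cohomology_class (\sum_i c i *: W i).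
Proof.
elim/big_rec2: _ => [|i U1 U2 _ ->].
  by apply: (addrI (cohomology_class 0)); rewrite addr0 -[RHS]to_lquotD addr0.
by rewrite /cohomology_class to_lquotD -lquot_scaleE.
Qed.

Lemma cocycle_sumE (I : finType) (c : I -> F) (W : I -> cocycle deg a) x :
  (\sum_i c i *: W i) x = \sum_i c i * W i x.
Proof.
have E : \val (\sum_i c i *: W i) = \sum_i c i *: \val (W i) :> (G -> F^o).
  by rewrite raddf_sum; apply: eq_bigr => i _; exact: linearZ.
by rewrite -[LHS]/(\val (\sum_i c i *: W i) x) E fct_sumE.
Qed.

(** The basis is dual to the generators [e_i] of the primary part: the
coordinates of the class of a cocycle are the values of its functional at the
[e_i]. *)
Lemma adapted_basis : (forall i, (0 < tnth q i)%N) ->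
  exists b : 'I_k -> cohomology deg a,
  [/\ forall y : cohomology deg a, exists c : 'I_k -> F, y = \sum_i c i *: b i,
      forall c : 'I_k -> F, \sum_i c i *: b i = 0 -> forall i, c i = 0 &
      forall n (c : 'I_k -> F), (2 <= n)%N ->
        (Cbar deg a n (\sum_i c i *: b i) <->
         forall i, (tnth q i < n - 1)%N -> c i = 0)].
Proof.
move=> q0; have [e [SE ker]] := hq.
have a1 : a != 1 := order_root_neq1 hdeg hM hDelta hroot.
have [g [ga gM]] := primary_projection hdeg hM a hDelta.
have /choice[Phi PhiP] := cocycle_functional hdeg hM a0.
have PhiE (U : cocycle deg a) : alexander_extends tens (cocycle_val U) (Phi U).
  by case: (PhiP U).
have unique (U : cocycle deg a) h :
    alexander_extends tens (cocycle_val U) h -> Phi U =1 h.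
  by move=> Uh; exact: (alexander_extends_unique hM (PhiE U) Uh).
pose co U i : F := Phi U (e i).
have co_sum (I : finType) (c : I -> F) (W : I -> cocycle deg a) i :
    co (\sum_j c j *: W j) i = \sum_j c j * co (W j) i.
  apply: (unique _ (fun m => \sum_j c j * Phi (W j) m)); split=> [m w|u z].
    rewrite -big_split; apply: eq_bigr => j _ /=.
    by have [-> _] := PhiE (W j); rewrite mulrDr.
  rewrite cocycle_sumE scaler_sumr; apply: eq_bigr => j _.
  by have [_ ->] := PhiE (W j); rewrite -[RHS]mulrCA.
(* Two cocycles are cohomologous when they have the same coordinates. A
   functional vanishing at the [e i] vanishes on [g M], hence everywhere, since
   [g] multiplies its values by the nonzero scalar [g.[a]]. *)
have class_co U U' : cohomology_class U = cohomology_class U' <-> co U =1 co U'.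
  have coB i : co (U - U') i = co U i - co U' i.
    pose c (j : bool) : F := if j then 1 else -1.
    pose W j := if j then U else U'.
    have := co_sum _ c W i; rewrite !big_bool /= scale1r scaleN1r => ->.
    by rewrite mul1r mulN1r.
  rewrite /cohomology_class to_lquotP; split.
    move=> /asboolP[d dE] i; apply/eqP; rewrite -subr_eq0 -coB; apply/eqP.
    apply: (alexander_extends_unique hM (PhiE _) (f2 := fun=> 0) (h2 := fun=> 0)).
      by split=> [m w|u z]; rewrite ?addr0 ?scaler0.
    by move=> u; rewrite dE (deg_derived hdeg) expr0z subrr mul0r.
  move=> UU'; apply: (cocycle_vanish_coboundary hdeg a0 a1) => u.
  have [_ /(_ u 1)] := PhiE (U - U'); rewrite scale1r => <-.
  set m := tens _ _; have [[PD _] Pp P0] := PhiP (U - U').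
  have Pz : Phi (U - U') 0 = 0.
    by apply: (addrI (Phi (U - U') 0)); rewrite -PD !addr0.
  apply: (mulfI ga); rewrite -Pp mulr0; have := gM m; rewrite SE => -[v ->].
  elim/big_rec: _ => [//|i w _ IHw]; rewrite PD IHw addr0; apply: P0.
  by rewrite -/(co (U - U') i) coB UU' subrr.
have of_row n (V : G -> 'rV[F]_n.+1) h : row_cocycle deg a V ->
    alexander_extends tens V h -> exists U : cocycle deg a,
      (forall x, U x = V x 0 0) /\ forall i, co U i = h (e i) 0 0.
  move=> VM [hD hE].
  have UP : (fun x => V x 0 0 : F^o) \in @cocycle_pred _ _ deg a.
    by apply/asboolP; exact: row_cocycle_head.
  exists (Cocycle UP); split=> // i.
  apply: (unique _ (fun m => h m 0 0)); split=> [m w|u z].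
    by rewrite hD mxE.
  by rewrite hE mxE.
have /choice[W WE] : forall j, exists U, forall i, co U i = (i == j)%:R.
  move=> j;
  have [|V [h [VM Vh hE]]] :=
    @row_cocycle_realize (fun i => (i == j)%:R) 0 e SE ker.
    by move=> i _; exact: q0.
  by have [U [_ UE]] := of_row _ _ _ VM Vh; exists U => i; rewrite UE hE.
have coW (c : 'I_k -> F) : co (\sum_j c j *: W j) =1 c.
  move=> i; rewrite co_sum (bigD1 i)//= WE eqxx mulr1 big1 ?addr0// => j ji.
  by rewrite WE eq_sym (negbTE ji) mulr0.
exists (fun j => cohomology_class (W j)); split.
- move=> y; exists (co (repr y)); rewrite cohomology_class_sum.
  rewrite -[LHS]to_lquot_repr; apply/class_co => i.
  by rewrite coW.
- move=> c; rewrite cohomology_class_sum => c0 i.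
  rewrite -(coW c); have -> : co (\sum_j c j *: W j) i = co 0 i.
    apply: ((class_co _ _).1 _ i); rewrite c0.
    by apply: (addrI (cohomology_class 0)); rewrite addr0 -[RHS]to_lquotD addr0.
  apply: (unique _ (fun=> 0)); split=> [m w|u z]; first by rewrite addr0.
  by rewrite -[LHS](scaler0 _ z).
move=> n c n2; rewrite cohomology_class_sum; split.
  move=> [U [V [V0 /(rho_morph_row_cocycle hdeg a0) VM]] /class_co Uc] i qi.
  rewrite -(coW c) -Uc.
  have [h [[hD hE] hZ]] := row_cocycle_extends hdeg hM a0 VM.
  have -> : co U i = h (e i) 0 0.
    apply: (unique _ (fun m => h m 0 0)); split=> [m w|u z].
      by rewrite hD mxE.
    by rewrite hE !mxE -V0.
  apply: (@jordan_inv_ker _ _ a (tnth q i)) => //.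
    by move: qi n2; case: (n) => [|[|n']]//; rewrite !subSS !subn0.
  (* The row [h (e i)] is killed by [A - a] to the power [tnth q i], because
     [e i] is killed by the same power of [s]. *)
  rewrite -laurent_alg_sub_const -rmorphXn -hZ.
  have -> : s ^+ tnth q i *: e i = 0.
    have <- : \sum_j ((i == j)%:R * s ^+ tnth q j) *: e j = 0.
      by apply/ker => j; exists (i == j)%:R.
    rewrite (bigD1 i)//= eqxx mul1r big1 ?addr0// => j ji.
    by rewrite eq_sym (negbTE ji) mul0r scale0r.
  by apply: (addrI (h 0)); rewrite -hD !addr0.
move=> cq; have [|V [h [VM Vh hE]]] := @row_cocycle_realize c (n - 2) e SE ker.
  move=> i; apply: contraNT; rewrite -leqNgt => qi; apply/eqP/cq.
  by rewrite (leq_ltn_trans qi)// ltn_sub2l.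
have [U [UE Uco]] := of_row _ _ _ VM Vh; exists U; last first.
  by apply/class_co => i; rewrite Uco hE coW.
exists (fun j x => V x 0 j); split; first by apply/funext => x; rewrite UE.
apply/(rho_morph_row_cocycle hdeg a0).
suff -> : (fun x => \row_j V x 0 j) = V by [].
by apply/funext => x; apply/rowP => j; rewrite mxE.
Qed.

End AdaptedBasis.

(** A coordinate subspace has the remaining basis vectors as a basis. *)
Lemma has_dim_coordinate (F : fieldType) (V : lmodType F) k (b : 'I_k -> V)
    (S : set V) (P : pred 'I_k) :
  (forall y, exists c : 'I_k -> F, y = \sum_i c i *: b i) ->
  (forall c : 'I_k -> F, \sum_i c i *: b i = 0 -> forall i, c i = 0) ->
  (forall c : 'I_k -> F, S (\sum_i c i *: b i) <-> forall i, ~~ P i -> c i = 0) ->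
  has_dim S #|P|.
Proof.
move=> gen free SP.
pose ext (d : 'I_#|P| -> F) i := \sum_(j | enum_val j == i) d j.
have extE d : \sum_j d j *: b (enum_val j) = \sum_i ext d i *: b i.
  rewrite (partition_big enum_val predT)//=; apply: eq_bigr => i _.
  by rewrite scaler_suml; apply: eq_bigr => j /eqP ->.
exists (fun j => b (enum_val j)); split; last first.
  move=> d; rewrite extE => /free d0 j; rewrite -[RHS](d0 (enum_val j)).
  rewrite /ext (big_pred1 j)// => j'; exact: (inj_eq enum_val_inj).
apply/seteqP; split=> [y Sy|y [d ->]].
  have [c yE] := gen y; exists (fun j => c (enum_val j)).
  have c0 : forall i, ~~ P i -> c i = 0 by apply/SP; rewrite -yE.
  rewrite yE -(big_enum_val (fun i => c i *: b i)) [RHS]big_mkcond /=.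
  apply: eq_bigr => i _; case: ifPn => // Pi.
  by rewrite c0 ?scale0r.
rewrite extE; apply/SP => i Pi; rewrite /ext big_pred0// => j.
by apply/eqP => ji; have := enum_valP j; rewrite ji => /(negP Pi).
Qed.

Lemma tnth_le_last k (q : k.-tuple nat) (i : 'I_k) :
  sorted leq q -> (tnth q i <= last 0%N q)%N.
Proof.
move=> qs; rewrite (tnth_nth 0%N) -nth_last.
have iq : (i < size q)%N by rewrite size_tuple.
apply: (sorted_leq_nth leq_trans leqnn) => //; rewrite ?inE //.
  by rewrite prednK//; exact: leq_ltn_trans iq.
by rewrite -ltnS prednK//; exact: leq_ltn_trans iq.
Qed.

Theorem mainTheorem3 (R : realType)
  (* the knot, a tubular neighbourhood, and a base point in the exterior *)
  (K : set 'rV[R]_4) (hK : is_knot K)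
  (E : (R * R) * (R * R) -> 'rV[R]_4) (hE : tubular_embedding K E)
  (x0 : exterior E)
  (* a meridian, and the map g |-> |g| *)
  (mu : pi1 R x0) (hmu : is_meridian mu)
  (deg : pi1 R x0 -> int) (hdeg : is_degree mu deg)
  (* the complex Alexander module and an Alexander polynomial *)
  (M : lmodType (laurent R[i]))
  (tens : abelianization (derived_group (pi1 R x0)) -> R[i] -> M)
  (hM : is_alexander_module mu tens)
  (Delta : laurent R[i]) (hDelta : is_order M Delta)
  (alpha : R[i]) (halpha : alpha != 0) (hroot : laurent_eval Delta alpha = 0)
  (* the decomposition of the (t - alpha)-primary part *)
  (k : nat) (q : k.-tuple nat)
  (hq : is_sum_of_cyclic
          (primary_part M (laurent_t R[i] - laurent_const alpha))
          (laurent_t R[i] - laurent_const alpha) q)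
  (hq1 : forall i : 'I_k, (1 <= tnth q i)%N) (hqs : sorted leq q) :
  let C n := Cbar deg alpha n in
  let qk := last 0%N q in
  [/\ (forall n, (2 <= n)%N ->
         (C n <> [set 0] <-> exists i : 'I_k, (n - 1 <= tnth q i)%N)),
      [/\ C (qk + 2)%N = [set 0],
          C (qk + 2)%N `<` C (qk + 1)%N,
          (forall p, (2 <= p <= qk)%N -> C p.+1 `<=` C p) &
          C 2%N = setT] &
      forall p, (3 <= p)%N ->
        exists d d' : nat,
          [/\ has_dim (C (p - 1)%N) d, has_dim (C p) d' &
              (d = d' + #|[pred i : 'I_k | tnth q i == (p - 2)%N]|)%N]].
Proof.
move=> C qk; have k0 := cyclic_summands_exist hdeg hM halpha hDelta hroot hq.
have [b [gen free CP]] := adapted_basis hdeg hM halpha hDelta hroot hq hq1.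
have bE i : b i = \sum_j (j == i)%:R *: b j.
  rewrite (bigD1 i)//= eqxx scale1r big1 ?addr0// => j /negbTE ->.
  by rewrite scale0r.
have b_neq0 i : b i <> 0.
  rewrite bE => /free/(_ i)/eqP; rewrite eqxx; exact/negP/oner_neq0.
have Cb n i : (2 <= n)%N -> (n - 1 <= tnth q i)%N -> C n (b i).
  move=> n2 ni; rewrite bE; apply/CP => // j qj.
  by case: eqP => // ji; rewrite ji ltnNge ni in qj.
have C0 n : (2 <= n)%N -> (forall i, (tnth q i < n - 1)%N) -> C n = [set 0].
  move=> n2 qn; apply/seteqP; split=> [y|y ->].
    have [c ->] := gen y; move=> /CP c0.
    by rewrite /= big1// => i _; rewrite c0// scale0r.
  have -> : 0 = \sum_i (fun=> 0) i *: b i by rewrite big1// => i _; rewrite scale0r.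
  exact/CP.
have Csub n n' : (2 <= n)%N -> (n <= n')%N -> C n' `<=` C n.
  move=> n2 nn' y; have [c ->] := gen y; move=> /CP c0; apply/CP => // i qi.
  by apply: c0; rewrite ?(leq_trans n2)// (leq_trans qi)// leq_sub2r.
have last_q : exists i : 'I_k, tnth q i = qk.
  have k1 : (k.-1 < k)%N by rewrite prednK.
  by exists (Ordinal k1); rewrite (tnth_nth 0%N) /qk -nth_last size_tuple.
have qk0 : (0 < qk)%N by have [i <-] := last_q.
have CT : C 2%N = setT.
  apply/seteqP; split=> // y _; have [c ->] := gen y; apply/CP => // i.
  by rewrite ltnNge hq1.
have Cqk2 : C (qk + 2)%N = [set 0].
  apply: C0 => [|i]; first exact: leq_addl.
  by rewrite addn2 subn1 ltnS tnth_le_last.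
have dimC n : (2 <= n)%N -> has_dim (C n) #|[pred i | n - 1 <= tnth q i]%N|.
  move=> n2; apply: (has_dim_coordinate gen free) => c.
  apply: (iff_trans (CP n c n2)).
  by split=> c0 i qi; apply: c0; move: qi; rewrite /= ltnNge.
split.
- move=> n n2; split=> [Cn0|[i qi] Cn].
    apply: contrapT => nq; apply: Cn0; apply: C0 => // i; rewrite ltnNge.
    by apply/negP => qi; apply: nq; exists i.
  by apply: (b_neq0 i); have := Cb n i n2 qi; rewrite Cn.
- split=> //.
    split; first by apply: Csub; rewrite ?leq_add2l// addn1.
    have [i qi] := last_q; rewrite Cqk2 => /(_ (b i)) bi; apply: (b_neq0 i).
    by apply: bi; apply: Cb; rewrite ?addn1// qi subn1.
  by move=> p /andP[p2 _]; apply: Csub.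
move=> p p3; exists #|[pred i | p - 1 - 1 <= tnth q i]%N|.
exists #|[pred i | p - 1 <= tnth q i]%N|; split.
- by apply: dimC; rewrite ltn_subRL.
- by apply: dimC; exact: ltnW.
rewrite -(cardID [pred i | p - 1 <= tnth q i]%N [pred i | p - 1 - 1 <= tnth q i]%N).
congr (_ + _)%N; apply: eq_card => i; rewrite !inE.
  apply/andP/idP => [[]//|pi]; split=> //; apply: leq_trans pi.
  by rewrite leq_subr.
rewrite -subnDA -ltnNge eqn_leq andbC.
have -> : (p - 1 = (p - 2).+1)%N by rewrite -subSn// ltnW.
by rewrite ltnS andbC.
Qed.
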